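(* Let $G$ be a compact abelian group and let $f$ be a continuous positive definite function on $G$. Then $f$ is strictly positive definite if and only if the support $\{\gamma \in \widehat{G} : \widehat{f}(\gamma) \neq 0\}$ of its Fourier transform is a strictly positive definite subset of $\widehat{G}$.
   Context: A function $f: G \to \mathbb{C}$ is positive definite if for all $n$, all $x_1,\dots,x_n \in G$ and all $c_1,\dots,c_n \in \mathbb{C}\setminus\{0\}$ one has $\sum_{i,j=1}^n c_i \overline{c_j} f(x_j^{-1}x_i) \ge 0$; it is strictly positive definite if moreover this sum is strictly positive whenever $x_1,\dots,x_n$ are pairwise distinct. A trigonometric polynomial on $\widehat{G}$ is a function of the form $\gamma \mapsto \sum_{i=1}^n c_i \gamma(x_i)$ with $x_i \in G$, $c_i \in \mathbb{C}$. A subset $K \subset \widehat{G}$ is strictly positive definite if the only trigonometric polynomial on $\widehat{G}$ vanishing at every point of $K$ is the identically zero function. *)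

(* Defs.v *)
(* mathcomp-analysis (topology, measure, Lebesgue integral)
   + mathcomp-real-closed (complex numbers R[i]). *)
From HB Require Import structures.
From mathcomp Require Import all_boot all_order all_algebra.
From mathcomp Require Import all_classical all_reals all_analysis.
From mathcomp Require Import complex.
Set Implicit Arguments. Unset Strict Implicit. Unset Printing Implicit Defensive.
Import Order.TTheory GRing.Theory Num.Theory.
Import numFieldTopology.Exports numFieldNormedType.Exports.
Local Open Scope classical_set_scope.
Local Open Scope ring_scope.

(* The usual (norm) topology on C = R[i]: the metric topology given by the
   absolute value, exactly as for any numFieldType (via the copy R[i]^o). *)
HB.instance Definition _ (R : rcfType) := PseudoPointedMetric.copy R[i] (R[i])^o.

(* The Borel sigma-algebra of a topological space, as a measurable type. *)
Definition pointed_of (G : zmodType) : Type := G.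
HB.instance Definition _ (G : zmodType) := Choice.on (pointed_of G).
HB.instance Definition _ (G : zmodType) := isPointed.Build (pointed_of G) 0.
Definition open_sets (G : topologicalZmodType) : set (set (pointed_of G)) :=
  @open G.
Notation borel_type G := (g_sigma_algebraType (@open_sets G)).

(* Continuous characters of the (additively written) abelian group G:
   continuous homomorphisms into the unit circle of C = R[i].
   The dual group \hat G is the set of these. *)
Definition character (R : realType) (G : topologicalZmodType)
    (g : G -> R[i]) : Prop :=
  continuous g /\ (forall x y : G, g (x + y) = g x * g y) /\
  (forall x : G, `|g x| = 1).

(* Positive definite functions: for all n >= 1, points x_1..x_n and
   nonzero coefficients c_1..c_n, sum_{i,j} c_i conj(c_j) f(x_j^{-1} x_i) >= 0
   (the group is written additively, so x_j^{-1} x_i is x_i - x_j; the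
   inequality 0 <= z in C means z is real and nonnegative). *)
Definition pd_sum (R : realType) (G : zmodType) (f : G -> R[i]) (n : nat)
    (x : 'I_n -> G) (c : 'I_n -> R[i]) : R[i] :=
  \sum_(i < n) \sum_(j < n) c i * (c j)^* * f (x i - x j).

Definition positive_definite (R : realType) (G : zmodType) (f : G -> R[i]) :=
  forall (n : nat) (x : 'I_n.+1 -> G) (c : 'I_n.+1 -> R[i]),
    (forall i, c i != 0) -> 0 <= pd_sum f x c.

Definition strictly_positive_definite (R : realType) (G : zmodType)
    (f : G -> R[i]) :=
  positive_definite f /\
  forall (n : nat) (x : 'I_n.+1 -> G) (c : 'I_n.+1 -> R[i]),
    (forall i, c i != 0) -> injective x -> 0 < pd_sum f x c.

(* The trigonometric polynomial gamma |-> sum_i c_i gamma(x_i) on \hat G. *)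
Definition trig_poly (R : realType) (G : zmodType) (n : nat)
    (x : 'I_n -> G) (c : 'I_n -> R[i]) (g : G -> R[i]) : R[i] :=
  \sum_(i < n) c i * g (x i).

(* A subset K of \hat G is strictly positive definite if the only
   trigonometric polynomial on \hat G vanishing on K is identically zero
   (on \hat G). *)
Definition spd_subset (R : realType) (G : topologicalZmodType)
    (K : set (G -> R[i])) :=
  forall (n : nat) (x : 'I_n -> G) (c : 'I_n -> R[i]),
    (forall g, K g -> trig_poly x c g = 0) ->
    forall g, character g -> trig_poly x c g = 0.

(* Fourier transform with respect to the (normalized) Haar measure mu:
   \hat f(gamma) = \int_G f(x) conj(gamma(x)) dmu(x), computed via the real
   and imaginary parts. *)
Definition fourier (R : realType) (G : topologicalZmodType)
    (mu : {measure set (borel_type G) -> \bar R}) (f : G -> R[i])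
    (g : G -> R[i]) : R[i] :=
  Complex (Rintegral mu setT (fun x : borel_type G => complex.Re (f x * (g x)^*)))
          (Rintegral mu setT (fun x : borel_type G => complex.Im (f x * (g x)^*))).

(* Normalized Haar measure on a compact abelian group: a translation-invariant
   Borel probability measure. *)
Definition haar_probability (R : realType) (G : topologicalZmodType)
    (mu : {measure set (borel_type G) -> \bar R}) :=
  mu setT = 1%E /\
  forall (a : G) (A : set (borel_type G)), measurable A ->
    mu [set (x : G) + a | x in A] = mu A.

(* Main.v *)
(* Everything rests on one fact: a nonzero continuous hermitian function [f] on [G]
   (that is, [f (- x) = (f x)^*]) has a nonzero Fourier coefficient.

   Convolution by [f] is a self-adjoint operator [T] on continuous functions, and it
   maps L2-bounded sets to equicontinuous ones; so, with [l] the supremum of [|T h|^2]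
   over [|h| <= 1], a maximizing sequence yields [u <> 0] with [T (T u) = l u].  The
   normalized autocorrelation of [u] is a positive definite function [p] with [p 0 = 1]
   and [T (T p) = l p].  All such [p] form a convex set which is compact for uniform
   convergence, and a [p] of maximal L2 norm is an extreme point of it.  For [|c| = 1] the
   functions [2 p x +- (c p (x + y) + c^* p (x - y))] are positive definite with sum
   [4 p]; hence they are multiples of [p], and [c = 1, 'i] give
   [p (x + y) = p x * p y].  So [p] is a character, and [fourier f p <> 0] as [l > 0].

   Given points [x_i] and coefficients [c_i], let [P] be the trigonometric polynomial
   and put [F y = \sum_(i, j) c_i (c_j)^* f (y + x_i - x_j)].  Then
   [fourier F g = |P g|^2 fourier f g] and [F 0] is the quadratic form of [f].  If [P]
   vanishes on the support of [fourier f], then [F = 0].  Conversely, if [F 0 = 0] then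
   [F = 0] by positive definiteness, so [P] vanishes on the support, hence everywhere
   when the support is strictly positive definite; replacing [f] by an even bump
   function vanishing at the [x_i - x_j] with [i <> j] gives
   [\sum_i |c_i|^2 = 0]. *)

Require Import Defs.
From HB Require Import structures.
From mathcomp Require Import all_boot all_order all_algebra.
From mathcomp Require Import all_classical all_reals all_analysis.
From mathcomp Require Import complex.
From mathcomp Require Import measurable_realfun ring lra.
Import Order.TTheory GRing.Theory Num.Theory.
Import numFieldTopology.Exports numFieldNormedType.Exports.
Local Open Scope classical_set_scope.
Local Open Scope ring_scope.

Set Implicit Arguments.
Unset Strict Implicit.
Unset Printing Implicit Defensive.

Local Notation Re := complex.Re.
Local Notation Im := complex.Im.

(** * Complex numbers through real and imaginary parts; the squared modulus *)

Section ComplexParts.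
Context {R : realType}.
Implicit Types z w : R[i].

Lemma complex_ext z w : Re z = Re w -> Im z = Im w -> z = w.
Proof. by case: z w => [a b] [c d] /= -> ->. Qed.

Lemma ReD z w : Re (z + w) = Re z + Re w. Proof. by case: z w => [? ?] []. Qed.
Lemma ImD z w : Im (z + w) = Im z + Im w. Proof. by case: z w => [? ?] []. Qed.
Lemma ReN z : Re (- z) = - Re z. Proof. by case: z. Qed.
Lemma ImN z : Im (- z) = - Im z. Proof. by case: z. Qed.
Lemma ReM z w : Re (z * w) = Re z * Re w - Im z * Im w.
Proof. by case: z w => [? ?] []. Qed.
Lemma ImM z w : Im (z * w) = Re z * Im w + Im z * Re w.
Proof. by case: z w => [? ?] []. Qed.
Lemma ReJ z : Re (z^*) = Re z. Proof. by case: z. Qed.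
Lemma ImJ z : Im (z^*) = - Im z. Proof. by case: z. Qed.
Lemma Re0 : Re (0 : R[i]) = 0. Proof. by []. Qed.
Lemma Im0 : Im (0 : R[i]) = 0. Proof. by []. Qed.
Lemma Re1 : Re (1 : R[i]) = 1. Proof. by []. Qed.
Lemma Im1 : Im (1 : R[i]) = 0. Proof. by []. Qed.

Definition partsE := (ReD, ImD, ReN, ImN, ReM, ImM, ReJ, ImJ, Re0, Im0, Re1, Im1).

(** The squared modulus with values in [R], whereas the norm of [R[i]] is valued in [R[i]];
    estimates become polynomial inequalities between reals. *)
Definition nsq z : R := Re z ^+ 2 + Im z ^+ 2.

Lemma nsq_ge0 z : 0 <= nsq z.
Proof. by rewrite addr_ge0 ?sqr_ge0. Qed.

Lemma nsq0 : nsq 0 = 0. Proof. by rewrite /nsq /= expr0n addr0. Qed.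

Lemma nsq_eq0 z : nsq z <= 0 -> z = 0.
Proof.
rewrite le_eqVlt ltNge nsq_ge0 orbF paddr_eq0 ?sqr_ge0// !sqrf_eq0.
by move=> /andP[/eqP ? /eqP ?]; apply: complex_ext.
Qed.

Lemma nsqM z w : nsq (z * w) = nsq z * nsq w.
Proof. by rewrite /nsq !partsE; ring. Qed.

Lemma nsqN z : nsq (- z) = nsq z. Proof. by rewrite /nsq !partsE !sqrrN. Qed.
Lemma nsqJ z : nsq z^* = nsq z. Proof. by rewrite /nsq !partsE sqrrN. Qed.

Lemma nsq_real (a : R) : nsq a%:C%C = a ^+ 2.
Proof. by rewrite /nsq /= expr0n addr0. Qed.

(** By the parallelogram identity the two sides differ by [nsq (z - w)]. *)
Lemma nsqD z w : nsq (z + w) <= 2 * nsq z + 2 * nsq w.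
Proof.
rewrite -subr_ge0; have := nsq_ge0 (z - w); rewrite /nsq !partsE.
by move: (Re z) (Re w) (Im z) (Im w) => a b c d; nra.
Qed.

Lemma nsqB z w : nsq (z - w) <= 2 * nsq z + 2 * nsq w.
Proof. by rewrite -(nsqN w) nsqD. Qed.

Lemma mulcJ_nsq z : z * z^* = (nsq z)%:C%C.
Proof. by apply: complex_ext; rewrite /nsq !partsE /=; ring. Qed.

Lemma norm_nsq z : `|z| ^+ 2 = (nsq z)%:C%C.
Proof. by rewrite -add_Re2_Im2. Qed.

Lemma norm1_nsq z : (`|z| = 1) <-> (nsq z = 1).
Proof.
split=> [z1|z1].
  by have := norm_nsq z; rewrite z1 expr1n => -[].
by apply/eqP; rewrite -(@pexpr_eq1 _ `|z| 2)// norm_nsq z1.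
Qed.

Lemma ge0_parts z : (0 <= z) <-> (0 <= Re z /\ Im z = 0).
Proof.
rewrite lecE /=; split=> [/andP[/eqP -> ->]//|[-> ->]]; by rewrite eqxx.
Qed.

(* Cauchy-Schwarz, from nonnegativity of the quadratic polynomial in [z]. *)
Lemma nsq_le_discriminant (A D : R) (B : R[i]) : 0 <= D ->
  (forall z, 0 <= A - 2 * Re (z^* * B) + nsq z * D) -> nsq B <= A * D.
Proof.
move=> D0 H.
(* Restricting to [z = t B] with [t] real leaves a real polynomial in [t]. *)
have HB t : 0 <= A - 2 * t * nsq B + t ^+ 2 * nsq B * D.
  have := H (t%:C%C * B); rewrite nsqM nsq_real.
  by rewrite /nsq !partsE /=; move: (Re B) (Im B) => a b; nra.
move: D0; rewrite le_eqVlt => /predU1P[D0|D0].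
  (* For [D = 0] the polynomial is affine in [t], and [t = (A + 1) / nsq B] makes it negative unless
     [B = 0]. *)
  rewrite -D0 mulr0 leNgt; apply/negP => B0.
  have := HB ((A + 1) / nsq B); rewrite -D0.
  have -> : 2 * ((A + 1) / nsq B) * nsq B = 2 * (A + 1).
    by field; rewrite gt_eqF.
  by have := HB 0; lra.
(* [D^-1] minimizes the polynomial. *)
have := HB D^-1; rewrite -[in X in X -> _](@ler_pM2r _ D)// mul0r.
have -> : (A - 2 * D^-1 * nsq B + D^-1 ^+ 2 * nsq B * D) * D = A * D - nsq B.
  by field; rewrite gt_eqF.
by rewrite subr_ge0.
Qed.

End ComplexParts.

(** * Continuity of complex-valued functions through their two parts *)

Section ComplexContinuity.
Context {R : realType} {T : topologicalType}.
Implicit Types h g : T -> R[i].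

Definition ccont h := continuous (fun x => Re (h x)) /\ continuous (fun x => Im (h x)).

Lemma ccontP h : continuous h <-> ccont h.
Proof.
(* A positive element of [R[i]] is real, so balls with real radii describe the neighbourhoods. *)
have nbE (z : R[i]) P : nbhs z P <->
    exists2 e : R, 0 < e & forall w, `|z - w| < e%:C%C -> P w.
  split=> [|[e e0 zP]].
    rewrite -nbhs_ballE => -[[a b]] /=; rewrite ltcE /= => /andP[/eqP b0 a0] zP.
    by exists a => // w zw; apply: zP; rewrite /ball /= b0.
  rewrite -nbhs_ballE; exists e%:C%C => //=; first by rewrite ltcR.
split=> [ch|[cr ci]].
  split=> x; apply/cvgrPdist_lt => e e0.
  - have : nbhs (h x) [set w | `|Re (h x) - Re w| < e].
      apply/nbE; exists e => // w /= hw.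
      rewrite -ltcR (le_lt_trans _ hw)// normc_def lecR.
      rewrite -ReN -ReD -sqrtr_sqr ler_sqrt ?addr_ge0 ?lerDl ?sqr_ge0//.
    by move=> /ch.
  - have : nbhs (h x) [set w | `|Im (h x) - Im w| < e].
      apply/nbE; exists e => // w /= hw.
      rewrite -ltcR (le_lt_trans _ hw)// normc_def lecR.
      rewrite -ImN -ImD -sqrtr_sqr ler_sqrt ?addr_ge0 ?lerDr ?sqr_ge0//.
    by move=> /ch.
move=> x P /nbE[e e0 hP].
have e2 : 0 < e / 2 by rewrite divr_gt0.
have /cvgrPdist_lt/(_ _ e2) cr1 := cr x.
have /cvgrPdist_lt/(_ _ e2) ci1 := ci x.
apply: filterS (filterI cr1 ci1) => y /= [h1 h2]; apply: hP.
rewrite normc_def ltcR -(ger0_norm (ltW e0)) -sqrtr_sqr ltr_sqrt ?exprn_gt0//.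
rewrite !partsE; move: h1 h2; rewrite !ltr_norml => /andP[h1 h2] /andP[h3 h4].
by move: (Re _ - Re _) (Im _ - Im _) h1 h2 h3 h4 => a b *; nra.
Qed.

Lemma ccont_cst (c : R[i]) : ccont (fun _ => c).
Proof. by split=> x; exact: cvg_cst. Qed.

Lemma ccontD h g : ccont h -> ccont g -> ccont (fun x => h x + g x).
Proof.
move=> [hr hi] [gr gi]; split=> x; rewrite /continuous_at.
  by under eq_fun do rewrite ReD; rewrite ReD; apply: cvgD; [exact: hr|exact: gr].
by under eq_fun do rewrite ImD; rewrite ImD; apply: cvgD; [exact: hi|exact: gi].
Qed.

Lemma ccontN h : ccont h -> ccont (fun x => - h x).
Proof.
move=> [hr hi]; split=> x; rewrite /continuous_at.
  by under eq_fun do rewrite ReN; rewrite ReN; apply: cvgN; exact: hr.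
by under eq_fun do rewrite ImN; rewrite ImN; apply: cvgN; exact: hi.
Qed.

Lemma ccontB h g : ccont h -> ccont g -> ccont (fun x => h x - g x).
Proof. by move=> ch cg; apply: ccontD => //; apply: ccontN. Qed.

Lemma ccontJ h : ccont h -> ccont (fun x => (h x)^*).
Proof.
move=> [hr hi]; split=> x; rewrite /continuous_at.
  by under eq_fun do rewrite ReJ; rewrite ReJ; exact: hr.
by under eq_fun do rewrite ImJ; rewrite ImJ; apply: cvgN; exact: hi.
Qed.

Lemma ccontM h g : ccont h -> ccont g -> ccont (fun x => h x * g x).
Proof.
move=> [hr hi] [gr gi]; split=> x; rewrite /continuous_at.
  under eq_fun do rewrite ReM; rewrite ReM; apply: cvgB; apply: cvgM;
  by [exact: hr|exact: gr|exact: hi|exact: gi].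
under eq_fun do rewrite ImM; rewrite ImM; apply: cvgD; apply: cvgM;
by [exact: hr|exact: gr|exact: hi|exact: gi].
Qed.

Lemma ccont_real (h : T -> R) : continuous h -> ccont (fun x => (h x)%:C%C).
Proof. by move=> ch; split=> // x; exact: cvg_cst. Qed.

Lemma ccont_sum (I : Type) (s : seq I) (h : I -> T -> R[i]) :
  (forall i, ccont (h i)) -> ccont (fun x => \sum_(i <- s) h i x).
Proof.
move=> ch; elim: s => [|i s IH].
  by under eq_fun do rewrite big_nil; exact: ccont_cst.
by under eq_fun do rewrite big_cons; exact: ccontD.
Qed.

Lemma continuous_nsq h : ccont h -> continuous (fun x => nsq (h x)).
Proof.
move=> [hr hi] x; rewrite /continuous_at /nsq !expr2.
under eq_fun do rewrite !expr2.
by apply: cvgD; apply: cvgM; by [exact: hr|exact: hi].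
Qed.

End ComplexContinuity.

Lemma ccont_comp {R : realType} {T U : topologicalType} (k : T -> U)
  (h : U -> R[i]) : continuous k -> ccont h -> ccont (fun x => h (k x)).
Proof.
move=> ck [hr hi]; split=> x.
  by apply: (@continuous_comp _ _ _ k (fun u => Re (h u))); [exact: ck|exact: hr].
by apply: (@continuous_comp _ _ _ k (fun u => Im (h u))); [exact: ck|exact: hi].
Qed.

(** * Uniform statements over a compact space *)

Section Compactness.
Context {R : realType} {T : topologicalType} (cT : compact [set: T]).

Lemma compact_finite_subcover (U : T -> set T) : (forall a, nbhs a (U a)) ->
  exists s : seq T, forall x, exists2 a, a \in s & U a x.
Proof.
move=> HU; have /compact_near_coveringP cov := cT.
(* The filter of finite lists directed by inclusion: near-covering compactness along it produces a
   single list valid for all points. *)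
pose F : set_system (seq T) :=
  filter_from [set: seq T] (fun s => [set t : seq T | {subset s <= t}]).
have FF : Filter F.
  apply: filter_from_filter; first by exists [::].
  move=> s t _ _; exists (s ++ t) => // r /= H.
  by split=> x xs; apply: H; rewrite mem_cat xs ?orbT.
have [|s _ /(_ s)Hs] := cov _ F (fun t x => exists2 a, a \in t & U a x).
  move=> x _; exists (U x, [set t : seq T | {subset [:: x] <= t}]) => /=.
    by split; [exact: HU|exists [:: x]].
  by move=> [y t] /= [Uy st]; exists x => //; apply: st; rewrite mem_head.
by exists s => x; apply: Hs.
Qed.

(** Tube lemma: near each [(x0, y)] the values stay within [e / 2] of [K x0 y], and compactness in
    [y] yields one neighbourhood of [x0]. *)
Lemma compact_uniform_near {U : topologicalType} (K : U -> T -> R) :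
  continuous (fun z : U * T => K z.1 z.2) ->
  forall x0 (e : R), 0 < e -> \forall x \near x0, forall y, `|K x y - K x0 y| <= e.
Proof.
move=> cK x0 e e0; have /compact_near_coveringP cov := cT.
have := cov _ (nbhs x0) (fun x y => `|K x y - K x0 y| <= e) _.
have H : forall y, [set: T] y -> \forall y' \near y & x \near x0, `|K x y' - K x0 y'| <= e.
  move=> y _; have e2 : 0 < e / 2 by rewrite divr_gt0.
  have /cvgrPdist_lt/(_ _ e2)[[A B] /= [Ax By] AB] := cK (x0, y).
  exists (B, A) => //= -[y' x] /= [By' Ax'].
  have := AB (x, y') (conj Ax' By'); have := AB (x0, y') (conj (nbhs_singleton Ax) By').
  move=> /= h1 h2.
  rewrite (_ : K x y' - K x0 y' = (K x0 y - K x0 y') - (K x0 y - K x y')); last ring.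
  by rewrite (le_trans (ler_normB _ _))// [e]splitr lerD// ltW.
move=> /(_ _ H); apply: filterS => x; move=> + y; exact.
Qed.

Lemma compact_continuous_bounded (h : T -> R) : continuous h ->
  exists2 B, 0 < B & forall x, `|h x| <= B.
Proof.
move=> ch; have : bounded_set (h @` setT).
  apply: compact_bounded; apply: continuous_compact => //.
  exact: continuous_subspaceT.
move=> [M [_ HM]]; exists (`|M| + 1); first by rewrite ltr_pwDr.
move=> x; apply: (HM (`|M| + 1)); last by exists x.
by rewrite ltr_pwDr// ler_norm.
Qed.

Lemma compact_ccont_bounded (h : T -> R[i]) : ccont h ->
  exists2 B, 0 < B & forall x, nsq (h x) <= B.
Proof.
move=> /continuous_nsq/compact_continuous_bounded[B B0 HB]; exists B => // x.
by rewrite (le_trans _ (HB x))// ler_norm.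
Qed.

End Compactness.

Lemma continuous_sum_seq {R : realType} {T : topologicalType} (I : Type) (s : seq I)
    (F : I -> T -> R) :
  (forall i, continuous (F i)) -> continuous (fun x => \sum_(i <- s) F i x).
Proof.
move=> cF; elim: s => [|i s IH] x; rewrite /continuous_at.
  by under eq_fun do rewrite big_nil; rewrite big_nil; exact: cvg_cst.
under eq_fun do rewrite big_cons; rewrite big_cons.
by apply: cvgD; [exact: cF|exact: IH].
Qed.

Lemma continuous_scale {R : realType} {T : topologicalType} (a : R) (h : T -> R) :
  continuous h -> continuous (fun x => a * h x).
Proof. by move=> ch x; apply: cvgM; [exact: cvg_cst|exact: ch]. Qed.

(** * The Haar integral of continuous real functions *)

Section HaarIntegral.
Context {R : realType} {G : topologicalZmodType} (cG : compact [set: G]).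
Variable mu : {measure set (borel_type G) -> \bar R}.
Hypothesis hmu : haar_probability mu.
Implicit Types h g : G -> R.

Definition IR h : R := Rintegral mu setT (h : borel_type G -> R).

Lemma open_measurable_borel (A : set G) : open A -> measurable (A : set (borel_type G)).
Proof. by move=> oA; apply: sub_sigma_algebra. Qed.

Lemma continuous_measurable_borel h : continuous h ->
  measurable_fun setT (h : borel_type G -> R).
Proof.
move=> /continuousP ch; apply: (measurability _ (RGenOpens.measurableE R)).
move=> _ [B [x [y ->]] <-]; rewrite setTI.
by apply: open_measurable_borel; apply: ch; exact: interval_open.
Qed.

Lemma translation_continuous (a : G) : continuous (fun x : G => x + a).
Proof.
move=> x.
apply: (@continuous_comp _ _ _ (fun x : G => (x, a)) (fun z : G * G => z.1 + z.2)).
  by apply: cvg_pair => /=; [exact: cvg_id|exact: cvg_cst].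
exact: add_continuous.
Qed.

Lemma continuous_translate h (a : G) : continuous h -> continuous (fun x => h (x + a)).
Proof.
move=> ch x; apply: (@continuous_comp _ _ _ (fun x : G => x + a) h); last exact: ch.
exact: translation_continuous.
Qed.

Lemma translation_measurable_borel (a : G) :
  measurable_fun setT ((fun x => x + a) : borel_type G -> borel_type G).
Proof.
apply: (@measurability _ _ (borel_type G) (borel_type G) _ _ (@open_sets G)) => //.
move=> _ [B oB <-]; rewrite setTI; apply: open_measurable_borel.
by apply: (open_comp _ oB) => x _; exact: translation_continuous.
Qed.

Lemma mu_fin (A : set (borel_type G)) : measurable A -> (mu A < +oo)%E.
Proof.
move=> mA; rewrite (@le_lt_trans _ _ (mu setT))//; last by rewrite hmu.1 ltry.
by rewrite le_measure// inE.
Qed.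

Lemma continuous_integrable h (A : set (borel_type G)) : continuous h ->
  measurable A -> mu.-integrable A (EFin \o (h : borel_type G -> R)).
Proof.
move=> ch mA; apply: measurable_bounded_integrable => //; first exact: mu_fin.
  apply: (@measurable_funS _ _ _ _ setT) => //; exact: continuous_measurable_borel.
have [B B0 HB] := compact_continuous_bounded cG ch.
exists B; split => //; first exact: num_real.
by move=> x Bx y _ /=; rewrite (le_trans (HB y))// ltW.
Qed.

Lemma IR_cst (c : R) : IR (fun _ => c) = c.
Proof. by rewrite /IR Rintegral_cst// hmu.1 mulr1. Qed.

Lemma IRD h g : continuous h -> continuous g ->
  IR (fun x => h x + g x) = IR h + IR g.
Proof. by move=> ch cg; apply: RintegralD => //; exact: continuous_integrable. Qed.

Lemma IRB h g : continuous h -> continuous g ->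
  IR (fun x => h x - g x) = IR h - IR g.
Proof. by move=> ch cg; apply: RintegralB => //; exact: continuous_integrable. Qed.

Lemma IRZ (c : R) h : continuous h -> IR (fun x => c * h x) = c * IR h.
Proof. by move=> ch; apply: RintegralZl => //; exact: continuous_integrable. Qed.

Lemma IRN h : continuous h -> IR (fun x => - h x) = - IR h.
Proof.
move=> ch; rewrite -[- IR h]mulN1r -IRZ//; congr IR.
by apply/funext => x; rewrite mulN1r.
Qed.

Lemma IR_ge0 h : (forall x, 0 <= h x) -> 0 <= IR h.
Proof. by move=> h0; apply: Rintegral_ge0. Qed.

Lemma le_IR h g : continuous h -> continuous g -> (forall x, h x <= g x) ->
  IR h <= IR g.
Proof. by move=> ch cg hg; apply: le_Rintegral => //; exact: continuous_integrable. Qed.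

Lemma IR_le_cst h (c : R) : continuous h -> (forall x, h x <= c) -> IR h <= c.
Proof. by move=> ch hc; rewrite -(IR_cst c) le_IR// => x; exact: cvg_cst. Qed.

Lemma norm_IR_le h (c : R) : continuous h -> (forall x, `|h x| <= c) -> `|IR h| <= c.
Proof.
move=> ch hc; rewrite ler_norml IR_le_cst ?andbT//; last first.
  by move=> x; rewrite (le_trans (ler_norm _)).
rewrite -(IR_cst (- c)) le_IR//; first by move=> x; exact: cvg_cst.
by move=> x; have := hc x; rewrite ler_norml => /andP[].
Qed.

Lemma IR_translate h (a : G) : continuous h -> IR (fun x => h (x + a)) = IR h.
Proof.
move=> ch; rewrite /IR /Rintegral; congr fine.
have ca := @continuous_translate h a ch.
have := @integral_pushforward _ _ (borel_type G) (borel_type G) R _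
  (translation_measurable_borel a) mu setT (EFin \o (h : borel_type G -> R)).
rewrite preimage_setT => <- //; last 2 first.
- by apply/measurable_EFinP; exact: continuous_measurable_borel.
- exact: (continuous_integrable ca).
apply: eq_measure_integral; first exact: translation_measurable_borel.
(* The preimage of [A] under translation by [a] is its image under translation by [- a]. *)
move=> mf A mA _; rewrite /= /pushforward -(hmu.2 (- a) A mA); congr (mu _).
apply/seteqP; split=> [x /= Ax|x /= [y Ay <-]].
  by exists (x + a) => //; rewrite addrK.
by rewrite subrK.
Qed.

Lemma IR_sum (I : Type) (s : seq I) (F : I -> G -> R) :
  (forall i, continuous (F i)) ->
  IR (fun x => \sum_(i <- s) F i x) = \sum_(i <- s) IR (F i).
Proof.
move=> cF; elim: s => [|i s IH].
  rewrite big_nil -[RHS](IR_cst 0); congr IR.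
  by apply/funext => x; rewrite big_nil.
rewrite big_cons -IH -IRD//; last exact: continuous_sum_seq.
by congr IR; apply/funext => x; rewrite big_cons.
Qed.

(* Some finite sum of translates of [h] is bounded below by a positive constant. *)
Lemma IR_gt0 h x0 : continuous h -> (forall x, 0 <= h x) -> 0 < h x0 -> 0 < IR h.
Proof.
move=> ch h0 hx0; have ct a := @continuous_translate h a ch.
(* Translation by [x0 - a] carries [a] to [x0], so this translate of [h] exceeds [h x0 / 2] near
   [a]. *)
have [] := @compact_finite_subcover _ cG (fun a => [set x | h x0 / 2 < h (x + (x0 - a))]).
  move=> a; have /cvgrPdist_lt/(_ (h x0 / 2)) := ct (x0 - a) a.
  rewrite divr_gt0// => /(_ isT); apply: filterS => x /=.
  by rewrite [a + _]addrC subrK ltr_norml => /andP[_]; lra.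
move=> s Hs.
have : h x0 / 2 <= IR (fun x => \sum_(a <- s) h (x + (x0 - a))).
  rewrite -(IR_cst (h x0 / 2)) le_IR//.
  - by move=> x; exact: cvg_cst.
  - exact: continuous_sum_seq.
  move=> x; have [a sa /= /ltW] := Hs x; move/le_trans; apply.
  by rewrite (big_rem a)//= lerDl sumr_ge0.
rewrite IR_sum//; under eq_bigr do rewrite IR_translate//.
rewrite ltNge => H; apply/negP => I0.
have : \sum_(i <- s) IR h <= 0 by apply: sumr_le0.
by move: H hx0; lra.
Qed.

End HaarIntegral.

Lemma eq0_small {R : realType} (x : R) : (forall e, 0 < e -> `|x| <= e) -> x = 0.
Proof.
move=> H; apply/eqP; rewrite -normr_le0 leNgt; apply/negP => x0.
have := H (`|x| / 2); rewrite divr_gt0// => /(_ isT); move: x0; lra.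
Qed.

(** * Exchange of two Haar integrals *)

Section Fubini.
Context {R : realType} {G : topologicalZmodType} (cG : compact [set: G]).
Variable mu : {measure set (borel_type G) -> \bar R}.
Hypothesis hmu : haar_probability mu.
Local Notation IR := (IR mu).

(** Induction on the cover: the piece of [D] inside [U a] is split off and its whole mass is placed
    at [a], where [h] is off by at most [e]. The rule [q] is chosen before [h], so it serves all
    functions with this oscillation bound at once. *)
Lemma quadrature_on (U : G -> set G) (e : R) (s : seq G) (D : set (borel_type G)) :
    (forall a, open (U a)) -> measurable D ->
    (forall x, D x -> exists2 a, a \in s & U a x) ->
  exists q : seq (G * R), forall h : G -> R, continuous h ->
    (forall a x, U a x -> `|h x - h a| <= e) ->
    `|Rintegral mu D (h : borel_type G -> R) - \sum_(u <- q) u.2 * h u.1|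
      <= e * fine (mu D).
Proof.
move=> oU; elim: s D => [|a s IH] D mD HD.
  have -> : D = set0 by apply/seteqP; split=> // x /HD[].
  exists [::] => h _ _.
  by rewrite big_nil Rintegral_set0 measure0 subrr normr0 mulr0.
have mU : measurable (U a : set (borel_type G)) by exact: open_measurable_borel.
have mD1 : measurable (D `&` (U a : set (borel_type G))) by exact: measurableI.
have mD2 : measurable (D `\` (U a : set (borel_type G))) by exact: measurableD.
have [|q Hq] := IH _ mD2.
  move=> x [Dx nUx]; have [b] := HD _ Dx.
  by rewrite inE => /predU1P[->//|bs Ub]; exists b.
exists ((a, fine (mu (D `&` (U a : set (borel_type G))))) :: q) => h ch hU.
have dis : [disjoint D `&` (U a : set (borel_type G)) & D `\` (U a : set (borel_type G))].
  by apply/disj_setPS => x /= [[_ ?] [_ ?]].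
have DE : D = (D `&` (U a : set (borel_type G))) `|` (D `\` (U a : set (borel_type G))).
  by rewrite setUIDK.
have -> : Rintegral mu D (h : borel_type G -> R) =
    Rintegral mu (D `&` (U a : set (borel_type G))) (h : borel_type G -> R) +
    Rintegral mu (D `\` (U a : set (borel_type G))) (h : borel_type G -> R).
  by rewrite {1}DE Rintegral_setU// -DE; exact: continuous_integrable.
have -> : fine (mu D) = fine (mu (D `&` (U a : set (borel_type G)))) +
    fine (mu (D `\` (U a : set (borel_type G)))).
  rewrite -fineD ?ge0_fin_numE ?mu_fin//.
  by rewrite [in LHS]DE measureU//; apply/disj_set2P.
rewrite big_cons /= mulrDr.
have h1 : `|Rintegral mu (D `&` (U a : set (borel_type G))) (h : borel_type G -> R)
    - fine (mu (D `&` (U a : set (borel_type G)))) * h a|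
    <= e * fine (mu (D `&` (U a : set (borel_type G)))).
  have cc (c : R) : continuous (fun _ : G => c) by move=> x; exact: cvg_cst.
  have ca : continuous (fun x => h x - h a).
    by move=> x; apply: cvgB; [exact: ch|exact: cvg_cst].
  have ci := continuous_integrable cG hmu.
  rewrite mulrC -Rintegral_cst// -RintegralB//; try exact: ci.
  rewrite (le_trans (le_normr_Rintegral _ _))//; first exact: (ci _ _ ca).
  rewrite -Rintegral_cst// le_Rintegral//.
  - apply: (ci (fun x => `|h x - h a|)) => // x.
    by apply: cvg_norm; exact: ca.
  - exact: (ci _ _ (cc e)).
  - by move=> x [_ Ux]; exact: hU.
rewrite opprD addrACA; apply: (le_trans (ler_normD _ _)).
by apply: lerD; [exact: h1|exact: Hq].
Qed.

Lemma continuous_curry_r {T : topologicalType} (K : T -> G -> R) :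
  continuous (fun z : T * G => K z.1 z.2) -> forall x, continuous (K x).
Proof.
move=> cK x y; apply: (@continuous_comp _ _ _ (fun y : G => (x, y)) (fun z => K z.1 z.2)).
  by apply: cvg_pair => /=; [exact: cvg_cst|exact: cvg_id].
exact: cK.
Qed.

Lemma continuous_IR {T : topologicalType} (K : T -> G -> R) :
  continuous (fun z : T * G => K z.1 z.2) -> continuous (fun x => IR (K x)).
Proof.
move=> cK x0; apply/cvgrPdist_le => e e0.
have := compact_uniform_near cG cK x0 e0; apply: filterS => x Hx.
have cKx := continuous_curry_r cK.
rewrite -IRB//; apply: norm_IR_le => //.
  by move=> y; apply: cvgB; exact: cKx.
by move=> y; rewrite distrC.
Qed.

Lemma continuous_swap (K : G -> G -> R) : continuous (fun z : G * G => K z.1 z.2) ->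
  continuous (fun z : G * G => K z.2 z.1).
Proof.
move=> cK z.
apply: (@continuous_comp _ _ _ (fun z : G * G => (z.2, z.1)) (fun z => K z.1 z.2)).
  by apply: cvg_pair => /=; [exact: cvg_snd|exact: cvg_fst].
exact: cK.
Qed.

(* The Borel sets of [G * G] need not be generated by rectangles, so the product
   measure is of no use; a quadrature rule approximating both sides is. *)
Lemma IR_fubini (K : G -> G -> R) : continuous (fun z : G * G => K z.1 z.2) ->
  IR (fun x => IR (K x)) = IR (fun y => IR (fun x => K x y)).
Proof.
move=> cK; have cKs := continuous_swap cK.
have cK1 := continuous_curry_r cK.
have cK2 : forall y, continuous (K^~ y) := continuous_curry_r cKs.
apply/eqP; rewrite -subr_eq0; apply/eqP/eq0_small => e e0.
have e2 : 0 < e / 2 by rewrite divr_gt0.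
(* On [U a] the bound is uniform in [y], so one rule applies both to every section [K^~ y] and to
   the integrated function. The interior makes [U a] open, hence Borel. *)
pose U a := ([set x | forall y, `|K x y - K a y| <= e / 2])°.
have [s Hs] : exists s : seq G, forall x, exists2 a, a \in s & U a x.
  apply: compact_finite_subcover => // a; apply: open_nbhs_nbhs; split.
    exact: open_interior.
  exact: (compact_uniform_near cG cK a e2).
have [|||q Hq] := @quadrature_on U (e / 2) s setT.
- by move=> a; exact: open_interior.
- exact: measurableT.
- by move=> x _; exact: Hs.
rewrite hmu.1 /= mulr1 in Hq.
have H1 : `|IR (fun x => IR (K x)) - \sum_(u <- q) u.2 * IR (K u.1)| <= e / 2.
  apply: (Hq (fun x => IR (K x))); first exact: continuous_IR.
  move=> a x /interior_subset /= Ux; rewrite -IRB//; apply: norm_IR_le => //.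
  by move=> y; apply: cvgB; exact: cK1.
have cS : continuous (fun y => \sum_(u <- q) u.2 * K u.1 y).
  by apply: continuous_sum_seq => u; exact: continuous_scale.
have H2 : `|IR (fun y => IR (fun x => K x y)) - \sum_(u <- q) u.2 * IR (K u.1)| <= e / 2.
  have -> : \sum_(u <- q) u.2 * IR (K u.1) = IR (fun y => \sum_(u <- q) u.2 * K u.1 y).
    rewrite IR_sum//; first by apply: eq_bigr => u _; rewrite IRZ.
    by move=> u; exact: continuous_scale.
  rewrite -IRB//; last exact: (continuous_IR cKs).
  apply: norm_IR_le => //.
    by move=> y; apply: cvgB; [exact: (continuous_IR cKs)|exact: cS].
  move=> y; apply: (Hq (K^~ y)) => // a x /interior_subset /= Ux; exact: Ux.
by move: H1 H2; rewrite !ler_norml => /andP[? ?] /andP[? ?]; apply/andP; split; lra.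
Qed.

End Fubini.

(** * The complex Haar integral, the L2 norm and Cauchy-Schwarz *)

Section ComplexIntegral.
Context {R : realType} {G : topologicalZmodType} (cG : compact [set: G]).
Variable mu : {measure set (borel_type G) -> \bar R}.
Hypothesis hmu : haar_probability mu.
Local Notation IR := (IR mu).
Implicit Types h g k : G -> R[i].

(** Split into parts exactly as in [fourier], so that a Fourier coefficient unfolds to an [IC]. *)
Definition IC h : R[i] := Complex (IR (fun x => Re (h x))) (IR (fun x => Im (h x))).

Definition sqnorm h : R := IR (fun x => nsq (h x)).

Lemma eq_IC h g : h =1 g -> IC h = IC g.
Proof. by move=> /funext ->. Qed.

Lemma ICD h g : ccont h -> ccont g -> IC (fun x => h x + g x) = IC h + IC g.
Proof.
move=> [hr hi] [gr gi]; apply: complex_ext; rewrite /IC !partsE /= -IRD//; congr IR;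
by apply/funext => x; rewrite !partsE.
Qed.

Lemma ICB h g : ccont h -> ccont g -> IC (fun x => h x - g x) = IC h - IC g.
Proof.
move=> [hr hi] [gr gi]; apply: complex_ext; rewrite /IC !partsE /= -IRB//; congr IR;
by apply/funext => x; rewrite !partsE.
Qed.

Lemma ICZ (c : R[i]) h : ccont h -> IC (fun x => c * h x) = c * IC h.
Proof.
move=> [hr hi]; apply: complex_ext; rewrite /IC !partsE /= -!IRZ//.
  rewrite -IRB; [|by []|by []|exact: (continuous_scale hr)|exact: (continuous_scale hi)].
  by congr IR; apply/funext => x; rewrite !partsE.
rewrite -IRD; [|by []|by []|exact: (continuous_scale hi)|exact: (continuous_scale hr)].
by congr IR; apply/funext => x; rewrite !partsE.
Qed.

Lemma ICZr (c : R[i]) h : ccont h -> IC (fun x => h x * c) = IC h * c.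
Proof. by move=> ch; rewrite mulrC -ICZ//; apply: eq_IC => x; rewrite mulrC. Qed.

Lemma ICJ h : ccont h -> IC (fun x => (h x)^*) = (IC h)^*.
Proof.
move=> [hr hi]; apply: complex_ext; rewrite /IC !partsE /=.
  by congr IR; apply/funext => x; rewrite !partsE.
by rewrite -IRN//; congr IR; apply/funext => x; rewrite !partsE.
Qed.

Lemma IC0 : IC (fun _ => 0) = 0.
Proof. by rewrite /IC /= IR_cst. Qed.

Lemma IC_sum (I : Type) (s : seq I) (F : I -> G -> R[i]) : (forall i, ccont (F i)) ->
  IC (fun x => \sum_(i <- s) F i x) = \sum_(i <- s) IC (F i).
Proof.
move=> cF; elim: s => [|i s IH].
  by rewrite big_nil -[RHS]IC0; apply: eq_IC => x; rewrite big_nil.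
rewrite big_cons -IH -ICD//; last exact: ccont_sum.
by apply: eq_IC => x; rewrite big_cons.
Qed.

Lemma IC_translate h (a : G) : ccont h -> IC (fun x => h (x + a)) = IC h.
Proof.
move=> [hr hi]; rewrite /IC; congr Complex.
  exact: (@IR_translate _ _ cG mu hmu (fun x => Re (h x))).
exact: (@IR_translate _ _ cG mu hmu (fun x => Im (h x))).
Qed.

Lemma ccont_IC {T : topologicalType} (K : T -> G -> R[i]) :
  ccont (fun z : T * G => K z.1 z.2) -> ccont (fun x => IC (K x)).
Proof.
move=> [Kr Ki]; split.
  exact: (@continuous_IR _ _ cG mu hmu _ (fun x y => Re (K x y))).
exact: (@continuous_IR _ _ cG mu hmu _ (fun x y => Im (K x y))).
Qed.

Lemma IC_fubini (K : G -> G -> R[i]) : ccont (fun z : G * G => K z.1 z.2) ->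
  IC (fun x => IC (K x)) = IC (fun y => IC (fun x => K x y)).
Proof.
move=> [Kr Ki]; rewrite /IC /=; congr Complex.
  exact: (@IR_fubini _ _ cG mu hmu (fun x y => Re (K x y))).
exact: (@IR_fubini _ _ cG mu hmu (fun x y => Im (K x y))).
Qed.

Lemma sqnorm_ge0 h : 0 <= sqnorm h.
Proof. by apply: IR_ge0 => x; exact: nsq_ge0. Qed.

Lemma sqnorm_eq0 h : ccont h -> sqnorm h <= 0 -> forall x, h x = 0.
Proof.
move=> ch h0 x; apply: nsq_eq0; rewrite leNgt; apply/negP => x0.
move: h0; rewrite leNgt => /negP; apply.
apply: (IR_gt0 cG hmu _ _ x0); first exact: continuous_nsq.
by move=> y; exact: nsq_ge0.
Qed.

Lemma sqnorm_le h (B : R) : ccont h -> (forall x, nsq (h x) <= B) -> sqnorm h <= B.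
Proof. by move=> ch; apply: IR_le_cst => //; exact: continuous_nsq. Qed.

Lemma sqnormZ (c : R[i]) h : ccont h -> sqnorm (fun x => c * h x) = nsq c * sqnorm h.
Proof.
move=> ch; rewrite -IRZ//; last exact: continuous_nsq.
by congr IR; apply/funext => x; rewrite nsqM.
Qed.

Lemma sqnormJ h : sqnorm (fun x => (h x)^*) = sqnorm h.
Proof. by congr IR; apply/funext => x; rewrite nsqJ. Qed.

Lemma IC_mulJ h : IC (fun x => h x * (h x)^*) = (sqnorm h)%:C%C.
Proof.
apply: complex_ext; rewrite /IC /=.
  by congr IR; apply/funext => x; rewrite mulcJ_nsq.
by rewrite -[RHS](IR_cst hmu 0); congr IR; apply/funext => x; rewrite mulcJ_nsq.
Qed.

(** Being nonnegative for all [z], this polynomial gives Cauchy-Schwarz through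
    [nsq_le_discriminant]; with [z] an approximate eigenvalue it measures the error in the
    eigenvalue equation. *)
Lemma sqnormBZ h g (z : R[i]) : ccont h -> ccont g ->
  sqnorm (fun x => h x - z * g x) =
  sqnorm h - 2 * Re (z^* * IC (fun x => h x * (g x)^*)) + nsq z * sqnorm g.
Proof.
move=> ch cg; have czg : ccont (fun x => z * g x).
  by apply: ccontM => //; exact: ccont_cst.
have chg : ccont (fun x => h x * (g x)^*) by apply: ccontM => //; exact: ccontJ.
have cz : ccont (fun x => z^* * (h x * (g x)^*)) by apply: ccontM => //; exact: ccont_cst.
rewrite -ICZ// /sqnorm /= -!IRZ//; try exact: continuous_nsq; try exact: cz.1.
rewrite -IRB//; try exact: continuous_nsq; try (exact: (continuous_scale cz.1)).
rewrite -IRD//.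
- by congr IR; apply/funext => x; rewrite /nsq !partsE; ring.
- by move=> x; apply: cvgB; [exact: continuous_nsq|exact: (continuous_scale cz.1)].
- by apply: continuous_scale; exact: continuous_nsq.
Qed.

Lemma IC_cauchy_schwarz k h : ccont k -> ccont h ->
  nsq (IC (fun x => k x * h x)) <= sqnorm k * sqnorm h.
Proof.
move=> ck ch; have cJ := ccontJ ch.
have -> : IC (fun x => k x * h x) = IC (fun x => k x * ((h x)^*)^*).
  by apply: eq_IC => x; rewrite conjCK.
rewrite -(sqnormJ h); apply: nsq_le_discriminant; first exact: sqnorm_ge0.
by move=> z; rewrite -sqnormBZ//; exact: sqnorm_ge0.
Qed.

End ComplexIntegral.

(** * Convolution by a fixed continuous function *)

Section Convolution.
Context {R : realType} {G : topologicalZmodType} (cG : compact [set: G]).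
Variable mu : {measure set (borel_type G) -> \bar R}.
Hypothesis hmu : haar_probability mu.
Variable f : G -> R[i].
Hypothesis cf : ccont f.
Local Notation IC := (IC mu).
Local Notation sqnorm := (sqnorm mu).
Implicit Types h g u v : G -> R[i].

Definition conv h (x : G) : R[i] := IC (fun y => f (x - y) * h y).

(** The cross-correlation; for [v = u] it is positive definite with value [sqnorm u] at [0]. *)
Definition correlation v u (x : G) : R[i] := IC (fun y => v (x + y) * (u y)^*).

Lemma ccont_fst {T U : topologicalType} (h : T -> R[i]) :
  ccont h -> ccont (fun z : T * U => h z.1).
Proof. by apply: ccont_comp => z; exact: cvg_fst. Qed.

Lemma ccont_snd {T U : topologicalType} (h : T -> R[i]) :
  ccont h -> ccont (fun z : U * T => h z.2).
Proof. by apply: ccont_comp => z; exact: cvg_snd. Qed.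

Lemma ccont_add2 h : ccont h -> ccont (fun z : G * G => h (z.1 + z.2)).
Proof. by apply: ccont_comp; exact: add_continuous. Qed.

Lemma ccont_sub2 h : ccont h -> ccont (fun z : G * G => h (z.1 - z.2)).
Proof. by apply: ccont_comp; exact: sub_continuous. Qed.

Lemma ccont_addl h (x : G) : ccont h -> ccont (fun y => h (x + y)).
Proof.
move=> /ccont_add2; apply: (@ccont_comp _ _ _ (fun y => (x, y))) => y.
by apply: cvg_pair => /=; [exact: cvg_cst|exact: cvg_id].
Qed.

Lemma ccont_addr h (a : G) : ccont h -> ccont (fun y => h (y + a)).
Proof. by apply: ccont_comp; exact: translation_continuous. Qed.

Lemma ccont_subl h (x : G) : ccont h -> ccont (fun y => h (x - y)).
Proof.
move=> /ccont_sub2; apply: (@ccont_comp _ _ _ (fun y => (x, y))) => y.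
by apply: cvg_pair => /=; [exact: cvg_cst|exact: cvg_id].
Qed.

Let csub x : ccont (fun y => f (x - y)) := ccont_subl x cf.

Lemma ccont_conv h : ccont h -> ccont (conv h).
Proof.
move=> ch; apply: (ccont_IC cG hmu (K := fun x y => f (x - y) * h y)).
by apply: ccontM; [exact: ccont_sub2|exact: ccont_snd].
Qed.

Lemma ccont_correlation v u : ccont v -> ccont u -> ccont (correlation v u).
Proof.
move=> cv cu; apply: (ccont_IC cG hmu (K := fun x y => v (x + y) * (u y)^*)).
by apply: ccontM; [exact: ccont_add2|exact/(@ccont_snd _ _ (fun y => (u y)^*))/ccontJ].
Qed.

Lemma convB h g : ccont h -> ccont g ->
  forall x, conv (fun y => h y - g y) x = conv h x - conv g x.
Proof.
move=> ch cg x; rewrite -ICB//; last 2 first.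
- by apply: ccontM => //; exact: csub.
- by apply: ccontM => //; exact: csub.
by apply: eq_IC => y; rewrite mulrBr.
Qed.

Lemma convZ (c : R[i]) h : ccont h -> forall x, conv (fun y => c * h y) x = c * conv h x.
Proof.
move=> ch x; rewrite -ICZ//; last by apply: ccontM => //; exact: csub.
by apply: eq_IC => y; rewrite mulrCA.
Qed.

Lemma conv_translate h (a : G) : ccont h ->
  forall x, conv (fun y => h (y + a)) x = conv h (x + a).
Proof.
move=> ch x; rewrite /conv.
rewrite -(@IC_translate _ _ cG mu hmu (fun y => f (x + a - y) * h y) a); last first.
  by apply: ccontM => //; exact: csub.
by apply: eq_IC => y; rewrite opprD addrACA subrr addr0.
Qed.

(** A correlation is a weighted integral of translates of [v]; convolution commutes with
    translations, and Fubini moves it under the integral. *)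
Lemma conv_correlation v u : ccont v -> ccont u ->
  forall x, conv (correlation v u) x = correlation (conv v) u x.
Proof.
move=> cv cu x; rewrite /conv /correlation.
have cK : ccont (fun z : G * G => f (x - z.1) * (v (z.1 + z.2) * (u z.2)^*)).
  apply: ccontM; first exact/(@ccont_fst _ _ (fun y => f (x - y)))/csub.
  by apply: ccontM; [exact: ccont_add2|exact/(@ccont_snd _ _ (fun y => (u y)^*))/ccontJ].
transitivity (IC (fun z => IC (fun y => f (x - z) * (v (z + y) * (u y)^*)))).
  apply: eq_IC => z; rewrite ICZ//.
  by apply: ccontM; [exact: ccont_addl|exact: ccontJ].
rewrite (IC_fubini cG hmu cK); apply: eq_IC => y.
rewrite -/(conv v (x + y)) -conv_translate// /conv -ICZr//.
  by apply: eq_IC => z; rewrite mulrA.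
apply: ccontM; first exact: csub.
exact: ccont_addr.
Qed.

Lemma nsq_conv_le (B : R) h : (forall x, nsq (f x) <= B) -> ccont h ->
  forall x, nsq (conv h x) <= B * sqnorm h.
Proof.
move=> HB ch x; apply: le_trans (IC_cauchy_schwarz cG hmu (csub x) ch) _.
by rewrite ler_wpM2r ?sqnorm_ge0// sqnorm_le//; exact: csub.
Qed.

(** Cauchy-Schwarz against [f (x - y) - f (x0 - y)], which is small uniformly in [y]; the
    neighbourhood therefore does not depend on [h]. *)
Lemma conv_equicontinuous (x0 : G) (e : R) : 0 < e ->
  \forall x \near x0, forall h, ccont h -> nsq (conv h x - conv h x0) <= e * sqnorm h.
Proof.
move=> e0.
have cK : continuous (fun z : G * G => nsq (f (z.1 - z.2) - f (x0 - z.2))).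
  apply: continuous_nsq; apply: ccontB; first exact: ccont_sub2.
  exact/(@ccont_snd _ _ (fun y => f (x0 - y)))/csub.
have := compact_uniform_near cG (K := fun x y => nsq (f (x - y) - f (x0 - y))) cK x0 e0.
apply: filterS => x Hx h ch.
have cd : ccont (fun y => f (x - y) - f (x0 - y)) by apply: ccontB; exact: csub.
have -> : conv h x - conv h x0 = IC (fun y => (f (x - y) - f (x0 - y)) * h y).
  rewrite /conv -ICB//; try (by apply: ccontM => //; exact: csub).
  by apply: eq_IC => y; rewrite mulrBl.
apply: le_trans (IC_cauchy_schwarz cG hmu cd ch) _.
rewrite ler_wpM2r ?sqnorm_ge0// sqnorm_le// => y.
by have := Hx y; rewrite subrr nsq0 subr0; apply: le_trans; exact: ler_norm.
Qed.

Hypothesis hf : forall x, f (- x) = (f x)^*.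

(** The kernel [f (x - y)] is hermitian by [hf]; Fubini exchanges the two variables. *)
Lemma conv_selfadjoint h g : ccont h -> ccont g ->
  IC (fun x => conv h x * (g x)^*) = IC (fun x => h x * (conv g x)^*).
Proof.
move=> ch cg.
have cK : ccont (fun z : G * G => f (z.1 - z.2) * h z.2 * (g z.1)^*).
  apply: ccontM; last exact/(@ccont_fst _ _ (fun y => (g y)^*))/ccontJ.
  by apply: ccontM; [exact: ccont_sub2|exact: ccont_snd].
transitivity (IC (fun x => IC (fun y => f (x - y) * h y * (g x)^*))).
  apply: eq_IC => x; rewrite ICZr//.
  by apply: ccontM => //; exact: csub.
rewrite (IC_fubini cG hmu cK); apply: eq_IC => y.
rewrite -ICJ//; last by apply: ccontM => //; exact: csub.
rewrite -ICZ//; last by apply: ccontJ; apply: ccontM => //; exact: csub.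
by apply: eq_IC => x; rewrite rmorphM /= -hf opprB [RHS]mulrCA mulrA.
Qed.

End Convolution.

(** * Uniform cluster points of equicontinuous sequences, after Arzela and Ascoli *)

Section UniformCluster.
Context {R : realType}.

Lemma norm_Re_le (z : R[i]) (e : R) : 0 <= e -> nsq z <= e ^+ 2 -> `|Re z| <= e.
Proof.
move=> e0 ze; rewrite -ler_sqr ?nnegrE// real_normK ?num_real//.
by rewrite (le_trans _ ze)// lerDl sqr_ge0.
Qed.

Lemma norm_Im_le (z : R[i]) (e : R) : 0 <= e -> nsq z <= e ^+ 2 -> `|Im z| <= e.
Proof.
move=> e0 ze; rewrite -ler_sqr ?nnegrE// real_normK ?num_real//.
by rewrite (le_trans _ ze)// lerDr sqr_ge0.
Qed.

Lemma nsqD3 (a b c : R[i]) : nsq (a + b + c) <= 4 * (nsq a + nsq b + nsq c).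
Proof.
have := nsqD (a + b) c; have := nsqD a b; have := nsq_ge0 a; have := nsq_ge0 b.
have := nsq_ge0 c; lra.
Qed.

Lemma ccont_near_nsq {T : topologicalType} (h : T -> R[i]) :
  ccont h <-> forall x0 (e : R), 0 < e -> \forall x \near x0, nsq (h x - h x0) <= e.
Proof.
split=> [[hr hi] x0 e e0|H].
  have ch : continuous (fun x => nsq (h x - h x0)).
    by apply: continuous_nsq; apply: ccontB => //; exact: ccont_cst.
  have /cvgrPdist_le/(_ _ e0) := ch x0; apply: filterS => x /=.
  by rewrite subrr nsq0 sub0r normrN; apply: le_trans; exact: ler_norm.
split=> x0; apply/cvgrPdist_le => e e0.
  have := H x0 (e ^+ 2); rewrite exprn_gt0// => /(_ isT); apply: filterS => x.
  by move=> /(norm_Re_le (ltW e0)); rewrite !partsE distrC.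
have := H x0 (e ^+ 2); rewrite exprn_gt0// => /(_ isT); apply: filterS => x.
by move=> /(norm_Im_le (ltW e0)); rewrite !partsE distrC.
Qed.

Lemma ccont_uniform_limit {T : topologicalType} (u : T -> R[i]) :
  (forall e : R, 0 < e -> exists2 g, ccont g & forall x, nsq (u x - g x) <= e) ->
  ccont u.
Proof.
move=> H; apply/ccont_near_nsq => x0 e e0.
have e12 : 0 < e / 12 by rewrite divr_gt0.
have [g /ccont_near_nsq cg ug] := H _ e12.
have := cg x0 _ e12; apply: filterS => x Hx.
have -> : u x - u x0 = (u x - g x) + (g x - g x0) + - (u x0 - g x0).
  by rewrite addrA subrK opprB addrA subrK.
apply: le_trans (nsqD3 _ _ _) _; rewrite nsqN.
by have := ug x; have := ug x0; move: Hx; lra.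
Qed.

(** Tychonoff, with one real coordinate for each part of each value, gives a pointwise cluster
    point; equicontinuity and a finite cover make the approximation uniform. *)
Lemma equicontinuous_uniform_cluster {T : topologicalType} (cT : compact [set: T])
    (s_ : nat -> T -> R[i]) (B : R) :
    (forall n x, nsq (s_ n x) <= B) ->
    (forall x0 (e : R), 0 < e ->
       \forall x \near x0, forall n, nsq (s_ n x - s_ n x0) <= e) ->
  exists u : T -> R[i], forall (e : R) (N : nat), 0 < e ->
    exists2 n, (N <= n)%N & forall x, nsq (u x - s_ n x) <= e.
Proof.
move=> sB sE.
have [[x1 _]|T0] := pselect ([set: T] !=set0); last first.
  exists (fun _ => 0) => e N e0; exists N => // x; exfalso; apply: T0; by exists x.
have B0 : 0 <= B by apply: le_trans (sB 0%N x1); exact: nsq_ge0.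
pose W n : prod_topology (fun _ : T * bool => R) :=
  fun i => if i.2 then Re (s_ n i.1) else Im (s_ n i.1).
pose A (i : T * bool) : set R := `[- (B + 1), B + 1]%classic.
have cA : compact [set w : prod_topology (fun _ : T * bool => R) | forall i, A i (w i)].
  by apply: tychonoff => i; exact: segment_compact.
have [|w [_ clw]] := cA (W @ \oo) _.
  exists 0%N => // n _ [x b]; rewrite /A /W /= in_itv /= -ler_norml.
  have B2 : B <= (B + 1) ^+ 2 by nra.
  have B1 : 0 <= B + 1 by lra.
  by case: b => /=; [apply: norm_Re_le|apply: norm_Im_le] => //; exact: le_trans (sB _ _) B2.
pose u x : R[i] := Complex (w (x, true)) (w (x, false)).
exists u.
(* A neighbourhood in the product topology controls finitely many coordinates, hence any finite list
   of points. *)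
have close (s : seq T) (e : R) N : 0 < e ->
    exists2 n, (N <= n)%N & forall x, x \in s -> nsq (u x - s_ n x) <= e.
  (* Since [d <= 1], [d ^+ 2 <= d <= e / 2], which bounds each of the two squares in [nsq]. *)
  move=> e0; pose d := Num.min 1 (e / 2).
  have d0 : 0 < d by rewrite lt_min ltr01 divr_gt0.
  have d1 : d <= 1 by rewrite ge_min lexx.
  have d2 : d <= e / 2 by rewrite ge_min lexx orbT.
  have P : (W @ \oo) [set W n | n in [set n | (N <= n)%N]].
    by exists N => // n /= Nn; exists n.
  have Q : nbhs w [set w' : prod_topology (fun _ : T * bool => R) |
      forall x, x \in s -> forall b, `|w (x, b) - w' (x, b)| < d].
    elim: s => [|a s IH]; first by apply: filterS (filterT) => w' _ x.
    have na b : nbhs w [set w' : prod_topology (fun _ : T * bool => R) |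
        `|w (a, b) - w' (a, b)| < d].
      have nb : nbhs (w (a, b)) [set t : R | `|w (a, b) - t| < d].
        by apply/nbhs_ballP; exists d.
      exact: (@proj_continuous _ (fun _ : T * bool => R) (a, b) w _ nb).
    apply: filterS (filterI IH (filterI (na true) (na false))).
    move=> w' /= [H [Ht Hf]] x; rewrite inE => /predU1P[->|/H//].
    by case.
  have [_ [[n /= Nn <-] Hn]] := clw _ _ P Q; exists n => // x xs.
  have sq (t : R) : `|t| < d -> t ^+ 2 <= e / 2.
    move=> /ltW td; rewrite -real_normK ?num_real// expr2 (le_trans _ d2)//.
    by rewrite -[d]mulr1 ler_pM// (le_trans td).
  by rewrite /nsq !partsE [e]splitr lerD// sq// (Hn x xs true, Hn x xs false).
(* [nsqD3] is used twice: first [4 * 3 = 12] units of [e / 60] for [u x - u a], then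
   [4 * (12 + 1 + 1) = 56] units in all. *)
move=> e N e0; have e1 : 0 < e / 60 by rewrite divr_gt0.
have [s Hs] := compact_finite_subcover cT (fun a => sE a _ e1).
have [n Nn Hn] := close s _ N e1; exists n => // x.
have [a sa /= Ha] := Hs x.
have uxa : nsq (u x - u a) <= 12 * (e / 60).
  have [m _ Hm] := close [:: x; a] _ 0%N e1.
  have -> : u x - u a = (u x - s_ m x) + (s_ m x - s_ m a) + - (u a - s_ m a).
    by rewrite addrA subrK opprB addrA subrK.
  apply: le_trans (nsqD3 _ _ _) _; rewrite nsqN.
  have := Hm x; rewrite mem_head => /(_ isT); have := Hm a; rewrite !inE eqxx orbT => /(_ isT).
  have := Ha m; lra.
have -> : u x - s_ n x = (u x - u a) + (u a - s_ n a) + - (s_ n x - s_ n a).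
  by rewrite addrA subrK opprB addrA subrK.
apply: le_trans (nsqD3 _ _ _) _; rewrite nsqN.
have := Hn a sa; have := Ha n; lra.
Qed.

End UniformCluster.

Lemma le0_small {R : realType} (x C : R) : 0 <= C ->
  (forall e, 0 < e -> x <= C * e) -> x <= 0.
Proof.
move=> C0 H; rewrite leNgt; apply/negP => x0.
have C1 : 0 < C + 1 by lra.
have := H (x / (C + 1)); rewrite divr_gt0// => /(_ isT).
rewrite mulrA ler_pdivlMr//; nra.
Qed.

(** * An eigenfunction of the square of the convolution operator *)

Section EigenFunction.
Context {R : realType} {G : topologicalZmodType} (cG : compact [set: G]).
Variable mu : {measure set (borel_type G) -> \bar R}.
Hypothesis hmu : haar_probability mu.
Variable f : G -> R[i].
Hypotheses (cf : ccont f) (hf : forall x, f (- x) = (f x)^*).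
Local Notation IC := (IC mu).
Local Notation sqnorm := (sqnorm mu).
Local Notation T := (conv mu f).
Implicit Types h g u : G -> R[i].

Lemma sqnorm_conv_le (B : R) h : (forall x, nsq (f x) <= B) -> ccont h ->
  sqnorm (T h) <= B * sqnorm h.
Proof.
move=> HB ch; apply: sqnorm_le => //; first exact: ccont_conv.
exact: nsq_conv_le.
Qed.

Let unit_ball h := ccont h /\ sqnorm h <= 1.
(** The square of the L2 operator norm of [T] on continuous functions. *)
Let lam := sup [set sqnorm (T h) | h in unit_ball].

Let unit_ball0 : unit_ball (fun _ => 0).
Proof.
split; first exact: ccont_cst.
apply: (sqnorm_le cG hmu); first exact: ccont_cst.
by move=> x; rewrite nsq0 ler01.
Qed.

Let has_sup_lam : has_sup [set sqnorm (T h) | h in unit_ball].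
Proof.
split; first by exists (sqnorm (T (fun _ => 0))); exists (fun _ => 0); first exact: unit_ball0.
have [B B0 HB] := compact_ccont_bounded cG cf; exists B => _ [h [ch h1] <-].
by apply: le_trans (sqnorm_conv_le HB ch) _; rewrite ler_piMr// ltW.
Qed.

Lemma sqnorm_conv_le_sup h : ccont h -> sqnorm (T h) <= lam * sqnorm h.
Proof.
move=> ch; have [h0|h0] := leP (sqnorm h) 0.
  have [B B0 HB] := compact_ccont_bounded cG cf.
  have := sqnorm_conv_le HB ch.
  have -> : sqnorm h = 0 by apply/eqP; rewrite eq_le h0 sqnorm_ge0.
  by rewrite !mulr0.
pose c : R[i] := ((Num.sqrt (sqnorm h))^-1)%:C%C.
have nc : nsq c = (sqnorm h)^-1 by rewrite nsq_real exprVn sqr_sqrtr// ltW.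
have ub : unit_ball (fun x => c * h x).
  split; first by apply: ccontM => //; exact: ccont_cst.
  by rewrite sqnormZ// nc mulVf// gt_eqF.
have : sqnorm (T (fun x => c * h x)) <= lam.
  by apply: ub_le_sup; [exact: has_sup_lam.2|exists (fun x => c * h x)].
have -> : sqnorm (T (fun x => c * h x)) = (sqnorm h)^-1 * sqnorm (T h).
  rewrite -nc -sqnormZ//; last exact: ccont_conv.
  by congr (IR mu _); apply/funext => x; rewrite convZ.
by rewrite mulrC ler_pdivrMr.
Qed.

(** Otherwise [T f = 0], whereas [T f 0] is the squared L2 norm of [f] by hermitian symmetry. *)
Lemma sup_conv_gt0 : ~ (forall x, f x = 0) -> 0 < lam.
Proof.
move=> f0; rewrite ltNge; apply/negP => l0; apply: f0.
apply: (sqnorm_eq0 cG hmu cf).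
have Tf0 : forall x, T f x = 0.
  apply: (sqnorm_eq0 cG hmu (ccont_conv cG hmu cf cf)).
  apply: le_trans (sqnorm_conv_le_sup cf) _.
  by rewrite mulr_le0_ge0// sqnorm_ge0.
have : T f 0 = (sqnorm f)%:C%C.
  by rewrite -(IC_mulJ hmu); apply: eq_IC => x; rewrite sub0r hf mulrC.
by rewrite Tf0 => -[<-].
Qed.

(** Here [u] is a uniform cluster point of [T h_n] for a maximizing sequence [h_n]. A nearly maximal
    [h] nearly satisfies [T (T h) = lam h]; applying [T] once more gives the equation for [u]. *)
Lemma conv_eigenfunction : ~ (forall x, f x = 0) ->
  exists l : R, 0 < l /\ exists u, [/\ ccont u, 0 < sqnorm u
    & forall x, T (T u) x = l%:C%C * u x].
Proof.
move=> f0; have l0 := sup_conv_gt0 f0; exists lam; split=> //.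
have [B B0 HB] := compact_ccont_bounded cG cf.
have exh n : exists h, unit_ball h /\ lam - n.+1%:R^-1 < sqnorm (T h).
  have [|_ [h uh <-] hn] := @sup_adherent _ _ n.+1%:R^-1 _ has_sup_lam.
    by rewrite invr_gt0.
  by exists h.
have [h_ Hh] := choice exh.
have ch n : ccont (h_ n) := (Hh n).1.1.
have h1 n : sqnorm (h_ n) <= 1 := (Hh n).1.2.
have cT g : ccont g -> ccont (T g) := ccont_conv cG hmu cf (h := g).
have [|x0 e e0|u Hu] := @equicontinuous_uniform_cluster _ _ cG (fun n => T (h_ n)) B.
- move=> n x; apply: le_trans (nsq_conv_le cG hmu cf HB (ch n) x) _.
  by rewrite ler_piMr// ltW.
- have := conv_equicontinuous cG hmu cf x0 e0; apply: filterS => x Hx n.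
  by apply: le_trans (Hx _ (ch n)) _; rewrite ler_piMr// ltW.
have small (e : R) : 0 < e -> exists2 h, [/\ ccont h, sqnorm h <= 1
    & lam - sqnorm (T h) <= e] & forall x, nsq (u x - T h x) <= e.
  move=> e0; have [k] := ltr_add_invr e0; rewrite add0r => ke.
  have [n kn Hn] := Hu e k e0; exists (h_ n) => //; split=> //.
  apply: (@le_trans _ _ n.+1%:R^-1); first by rewrite lerBlDr -lerBlDl ltW// (Hh n).2.
  by apply: le_trans (ltW ke); rewrite lef_pV2 ?posrE// ler_nat.
have cu : ccont u.
  apply: ccont_uniform_limit => e e0.
  by have [h [hc _ _] Hh'] := small e e0; exists (T h) => //; exact: cT.
exists u; split=> //.
  (* If [u = 0], some [h] has [sqnorm (T h)] both at most [lam / 3] and at least [2 * lam / 3]. *)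
  rewrite ltNge; apply/negP => u0.
  have l3 : 0 < lam / 3 by rewrite divr_gt0.
  have [h [hc _ hl] Hh'] := small _ l3.
  have : sqnorm (T h) <= lam / 3.
    apply: sqnorm_le => //; first exact: cT.
    by move=> x; have := Hh' x; rewrite (sqnorm_eq0 cG hmu cu u0) sub0r nsqN.
  lra.
move=> x; apply/eqP; rewrite -subr_eq0; apply/eqP/nsq_eq0.
(* The factor [4] is that of [nsqD3]; the summands bound [T (T d)], [lam d] and [T E] below. *)
apply: (@le0_small _ _ (4 * (B ^+ 2 + lam ^+ 2 + B * lam))).
  by rewrite mulr_ge0// !addr_ge0 ?sqr_ge0// mulr_ge0// ltW.
move=> e e0; have [h [hc h1' hl] Hh'] := small e e0.
pose E y := T (T h) y - lam%:C%C * h y.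
have clh : ccont (fun y => lam%:C%C * h y) by apply: ccontM => //; exact: ccont_cst.
have cE : ccont E by apply: ccontB => //; exact/cT/cT.
(* Self-adjointness turns the cross term into [sqnorm (T h)], so the expansion is at most
   [lam * (lam - sqnorm (T h))]. *)
have NE : sqnorm E <= lam * e.
  rewrite sqnormBZ//; last exact/cT/cT.
  rewrite (conv_selfadjoint cG hmu cf hf (cT _ hc) hc) IC_mulJ// nsq_real !partsE /=.
  have := sqnorm_conv_le_sup (cT _ hc).
  have := sqnorm_ge0 mu h; move: l0 hl h1'.
  move: lam (sqnorm h) (sqnorm (T h)) (sqnorm (T (T h))) => l a b c; nra.
have TE : nsq (T E x) <= B * (lam * e).
  by apply: le_trans (nsq_conv_le cG hmu cf HB cE x) _; rewrite ler_wpM2l// ltW.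
pose d y := u y - T h y.
have cd : ccont d by apply: ccontB => //; exact: cT.
have Nd : sqnorm d <= e by apply: sqnorm_le.
have TTd : nsq (T (T d) x) <= B * (B * e).
  apply: le_trans (nsq_conv_le cG hmu cf HB (cT _ cd) x) _.
  rewrite ler_wpM2l ?(ltW B0)//; apply: le_trans (sqnorm_conv_le HB cd) _.
  by rewrite ler_wpM2l ?(ltW B0).
have ld : nsq (lam%:C%C * d x) <= lam ^+ 2 * e.
  by rewrite nsqM nsq_real ler_wpM2l ?sqr_ge0// Hh'.
have TTdE : T (T d) x = T (T u) x - T (T (T h)) x.
  have -> : T d = (fun y => T u y - T (T h) y).
    by apply/funext => y; rewrite convB//; exact: cT.
  by rewrite convB//; [exact: cT|exact/cT/cT].
have TEE : T E x = T (T (T h)) x - lam%:C%C * T h x.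
  by rewrite convB// ?convZ//; exact/cT/cT.
have -> : T (T u) x - lam%:C%C * u x = T (T d) x + T E x + - (lam%:C%C * d x).
  rewrite TTdE TEE /d; move: (T (T u) x) (T (T (T h)) x) (T h x) (u x) => a b c k.
  by ring.
apply: le_trans (nsqD3 _ _ _) _; rewrite nsqN.
move: TE TTd ld; lra.
Qed.

End EigenFunction.

(** * Positive definite functions and finitely supported measures *)

Section PositiveDefinite.
Context {R : realType} {G : zmodType}.
Implicit Types (f g d : G -> R[i]) (s t L : seq (G * R[i])).

(** A list of weighted points encodes a finitely supported complex measure, and [wsum] integrates
    against it; repeated points and zero weights are allowed. *)
Definition wsum L f : R[i] := \sum_(w <- L) w.2 * f w.1.

(** The convolution of the measure [s] with its adjoint, so that integrating [f] against it gives
    the quadratic form of [f]. *)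
Definition diffs s : seq (G * R[i]) :=
  [seq (u.1 - v.1, u.2 * (v.2)^*) | u <- s, v <- s].

Lemma wsum_diffs s f : wsum (diffs s) f =
  \sum_(u <- s) \sum_(v <- s) u.2 * (v.2)^* * f (u.1 - v.1).
Proof. by rewrite /wsum big_allpairs_dep. Qed.

(** Unlike [positive_definite], this form admits zero weights and the empty list, so any list can be
    substituted. *)
Definition pdf f := forall s, 0 <= wsum (diffs s) f.

(* The convolution of [f] with [nu] and its adjoint, for the atomic measure
   [nu] with masses [w.2] at the points [- w.1], [w] in [s]. *)
Definition smear f s (y : G) : R[i] := wsum (diffs s) (fun x => f (y + x)).

Lemma smear0 f s : smear f s 0 = wsum (diffs s) f.
Proof. by apply: eq_bigr => w _; rewrite add0r. Qed.

Lemma pd_sum_wsum f n (x : 'I_n -> G) (c : 'I_n -> R[i]) :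
  pd_sum f x c = wsum (diffs [seq (x i, c i) | i <- index_enum 'I_n]) f.
Proof.
rewrite wsum_diffs big_map; apply: eq_bigr => i _.
by rewrite big_map.
Qed.

Lemma wsum_diffs_filter s f :
  wsum (diffs [seq u <- s | u.2 != 0]) f = wsum (diffs s) f.
Proof.
rewrite !wsum_diffs big_filter big_mkcond /=; apply: eq_bigr => u _.
case: eqP => [->|_] /=; first by rewrite big1// => v _; rewrite !mul0r.
rewrite big_filter big_mkcond /=; apply: eq_bigr => v _.
by case: eqP => [->|//]; rewrite conjC0 mulr0 mul0r.
Qed.

Lemma wsum_diffs_nth s f : wsum (diffs s) f =
  pd_sum f (fun i : 'I_(size s) => (nth (0, 0) s i).1) (fun i => (nth (0, 0) s i).2).
Proof.
rewrite wsum_diffs (big_nth (0, 0)) big_mkord; apply: eq_bigr => i _.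
by rewrite (big_nth (0, 0)) big_mkord.
Qed.

Lemma positive_definite_pdf f : positive_definite f -> pdf f.
Proof.
move=> pf s; rewrite -wsum_diffs_filter.
have : all (fun u => u.2 != 0) [seq u <- s | u.2 != 0] by exact: filter_all.
move: [seq u <- s | u.2 != 0] => {}s sn0; rewrite wsum_diffs_nth.
move: sn0; case E : (size s) => [|n] sn0; first by rewrite /pd_sum big_ord0.
by apply: pf => i; apply: (allP sn0); rewrite mem_nth// E.
Qed.

(** The list on the left is the convolution product of the measures [t] and [s]; regrouping its
    quadratic form shows that smearing preserves positive definiteness. *)
Lemma wsum_diffs_prod s t f : wsum (diffs [seq (u.1 + v.1, u.2 * v.2) | u <- t, v <- s]) f =
  wsum (diffs t) (smear f s).
Proof.
rewrite !wsum_diffs big_allpairs_dep; apply: eq_bigr => u _.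
under eq_bigr do rewrite big_allpairs_dep.
rewrite exchange_big /=; apply: eq_bigr => u' _.
rewrite /smear wsum_diffs mulr_sumr; apply: eq_bigr => v _.
rewrite mulr_sumr; apply: eq_bigr => v' _.
rewrite rmorphM /= opprD addrACA !mulrA; congr (_ * _).
by rewrite -!mulrA; congr (_ * _); rewrite mulrCA.
Qed.

Lemma pdf_smear f s : pdf f -> pdf (smear f s).
Proof. by move=> pf t; rewrite -wsum_diffs_prod. Qed.

Lemma wsumB L f g : wsum L (fun x => f x - g x) = wsum L f - wsum L g.
Proof. by rewrite /wsum -sumrB; apply: eq_bigr => w _; rewrite mulrBr. Qed.

Lemma wsumZ L (c : R[i]) f : wsum L (fun x => c * f x) = c * wsum L f.
Proof. by rewrite /wsum mulr_sumr; apply: eq_bigr => w _; rewrite mulrCA. Qed.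

Lemma pdfZ (c : R) f : 0 <= c -> pdf f -> pdf (fun x => c%:C%C * f x).
Proof. by move=> c0 pf s; rewrite wsumZ mulr_ge0// ler0c. Qed.

(** For [|c| = 1], and with [c] replaced by [- c], these are the two functions with sum [4 f] used
    for extremality. *)
Lemma smear2 f (y : G) (c : R[i]) x : smear f [:: (0, 1); (y, c)] x =
  f x + c^* * f (x - y) + (c * f (x + y) + c * c^* * f x).
Proof.
rewrite /smear wsum_diffs !big_cons !big_nil /= !addr0 conjC1 !mul1r mulr1.
by rewrite !subrr !subr0 !addr0 sub0r.
Qed.

Section Facts.
Variable f : G -> R[i].
Hypothesis pf : pdf f.

Lemma pdf0_ge0 : 0 <= f 0.
Proof.
have := pf [:: (0, 1)]; rewrite wsum_diffs !big_seq1 /=.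
by rewrite conjC1 !mul1r subrr.
Qed.

Lemma pdf0E : f 0 = (Re (f 0))%:C%C.
Proof. by have /ge0_parts[_ i0] := pdf0_ge0; apply: complex_ext. Qed.

(** The quadratic form at the points [x] and [0] with weights [1] and [z]: the values [1] and ['i]
    of [z] give hermitian symmetry, and arbitrary [z] the bound by [f 0]. *)
Let pdf2 x (z : R[i]) :
  0 <= f 0 + z^* * f x + (z * f (- x) + z * z^* * f 0).
Proof.
have := pf [:: (x, 1); (0, z)]; rewrite wsum_diffs !big_cons !big_nil /=.
by rewrite !addr0 conjC1 !mul1r mulr1 !subrr !subr0 !sub0r.
Qed.

Lemma pdf_hermitian x : f (- x) = (f x)^*.
Proof.
have /ge0_parts[_ i0] := pdf0_ge0.
have /ge0_parts[_] := pdf2 x 1; have /ge0_parts[_] := pdf2 x (Complex 0 1).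
rewrite !partsE /= i0 => h1 h2.
by apply: complex_ext; rewrite !partsE; lra.
Qed.

Lemma pdf_nsq_le x : nsq (f x) <= Re (f 0) ^+ 2.
Proof.
have /ge0_parts[r0 i0] := pdf0_ge0.
rewrite -nsqN expr2; apply: nsq_le_discriminant => // z.
have /ge0_parts[+ _] := pdf2 x z; rewrite pdf_hermitian /nsq !partsE i0; lra.
Qed.

Lemma pdf_eq0 : f 0 = 0 -> forall x, f x = 0.
Proof. by move=> f0 x; apply: nsq_eq0; have := pdf_nsq_le x; rewrite f0 /= expr0n. Qed.

End Facts.

Lemma nsq_wsum_le L : exists2 C : R, 0 <= C &
  forall d (e : R), 0 <= e -> (forall x, nsq (d x) <= e) -> nsq (wsum L d) <= C * e.
Proof.
elim: L => [|w L [C C0 HC]].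
  by exists 0 => // d e e0 _; rewrite /wsum big_nil nsq0 mul0r.
exists (2 * nsq w.2 + 2 * C).
  by rewrite addr_ge0// mulr_ge0// nsq_ge0.
move=> d e e0 de; rewrite /wsum big_cons -/(wsum L d).
apply: le_trans (nsqD _ _) _; rewrite nsqM [leRHS]mulrDl -!mulrA.
by rewrite lerD// ler_wpM2l// ?HC// ler_wpM2l ?nsq_ge0.
Qed.

Lemma pdf_uniform_limit f :
  (forall e : R, 0 < e -> exists2 g, pdf g & forall x, nsq (f x - g x) <= e) -> pdf f.
Proof.
move=> H s; have [C C0 HC] := nsq_wsum_le (diffs s).
set z := wsum _ f.
have zw (e : R) : 0 < e -> exists2 w : R[i], 0 <= w & nsq (z - w) <= C * e.
  move=> e0; have [g pg fg] := H e e0; exists (wsum (diffs s) g) => //.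
  by rewrite /z -wsumB HC// ltW.
apply/ge0_parts; split; last first.
  apply/eqP; rewrite -sqrf_eq0 eq_le sqr_ge0 andbT.
  apply: (le0_small C0) => e e0; have [w /ge0_parts[_ w0] zwe] := zw e e0.
  by apply: le_trans zwe; rewrite /nsq !partsE w0 oppr0 addr0 lerDr sqr_ge0.
(* If [Re z < 0], every [w >= 0] is at distance at least [|Re z|] from [z]. *)
rewrite leNgt; apply/negP => z0.
have : Re z ^+ 2 <= 0.
  apply: (le0_small C0) => e e0; have [w /ge0_parts[w0 _] zwe] := zw e e0.
  apply: le_trans zwe; rewrite /nsq !partsE ler_wpDr ?sqr_ge0//.
  by move: (Re z) (Re w) w0 z0 => a b *; nra.
by rewrite leNgt exprn_even_gt0//= lt_eqF.
Qed.

End PositiveDefinite.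

Lemma ccont_smear {R : realType} {G : topologicalZmodType} (f : G -> R[i])
    (s : seq (G * R[i])) : ccont f -> ccont (smear f s).
Proof.
move=> cf; apply: ccont_sum => w; apply: ccontM; first exact: ccont_cst.
exact: (ccont_addr w.1 cf).
Qed.

(** * Extremal positive definite eigenfunctions are characters *)

Section ExtremalCharacter.
Context {R : realType} {G : topologicalZmodType} (cG : compact [set: G]).
Variable mu : {measure set (borel_type G) -> \bar R}.
Hypothesis hmu : haar_probability mu.
Variable f : G -> R[i].
Hypotheses (cf : ccont f) (hf : forall x, f (- x) = (f x)^*).
Local Notation IC := (IC mu).
Local Notation sqnorm := (sqnorm mu).
Local Notation T := (conv mu f).
Implicit Types p q u : G -> R[i].

Let cT g : ccont g -> ccont (T g) := ccont_conv cG hmu cf (h := g).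

(** A convex cone, of which [eigenbase] is the section by [p 0 = 1]; extreme points are sought in
    that section. *)
Definition eigencone (l : R) q :=
  [/\ ccont q, pdf q & forall x, T (T q) x = l%:C%C * q x].

Definition eigenbase (l : R) p := eigencone l p /\ p 0 = 1.

Lemma correlation_sub u (a b : G) : ccont u ->
  correlation mu u u (a - b) = IC (fun y => u (a + y) * (u (b + y))^*).
Proof.
move=> cu; rewrite /correlation.
rewrite -(@IC_translate _ _ cG mu hmu (fun y => u (a - b + y) * (u y)^*) b).
  by apply: eq_IC => y; rewrite -addrA [y + b]addrC addKr.
by apply: ccontM; [exact: ccont_addl|exact: ccontJ].
Qed.

Lemma correlation0 u : correlation mu u u 0 = (sqnorm u)%:C%C.
Proof. by rewrite -(IC_mulJ hmu); apply: eq_IC => y; rewrite add0r. Qed.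

(** The quadratic form is the squared L2 norm of the combination [S] of translates of [u]. *)
Lemma pdf_correlation u : ccont u -> pdf (correlation mu u u).
Proof.
move=> cu s; rewrite wsum_diffs.
have cua a : ccont (fun y => u (a + y)) := ccont_addl a cu.
pose S y := \sum_(w <- s) w.2 * u (w.1 + y).
suff -> : \sum_(w <- s) \sum_(v <- s) w.2 * (v.2)^* * correlation mu u u (w.1 - v.1)
    = (sqnorm S)%:C%C by rewrite ler0c sqnorm_ge0.
have cwv (w v : G * R[i]) : ccont (fun y => u (w.1 + y) * (u (v.1 + y))^*).
  by apply: ccontM => //; apply: ccontJ (cua _).
have cwv' (w v : G * R[i]) :
    ccont (fun y => w.2 * (v.2)^* * (u (w.1 + y) * (u (v.1 + y))^*)).
  by apply: ccontM => //; exact: ccont_cst.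
rewrite -(IC_mulJ hmu).
transitivity (IC (fun y => \sum_(w <- s) \sum_(v <- s)
    w.2 * (v.2)^* * (u (w.1 + y) * (u (v.1 + y))^*))).
  rewrite IC_sum//; last by move=> w; exact: ccont_sum.
  apply: eq_bigr => w _; rewrite IC_sum//; apply: eq_bigr => v _.
  by rewrite ICZ// correlation_sub.
apply: eq_IC => y; rewrite /S mulr_suml; apply: eq_bigr => w _.
rewrite rmorph_sum mulr_sumr; apply: eq_bigr => v _ /=.
by rewrite rmorphM /=; move: (u _) (u _)^* => a b; rewrite mulrACA.
Qed.

(** The autocorrelation of the eigenfunction [u], divided by [sqnorm u]: [T] acts on the first
    factor only, so the eigenvalue is kept. *)
Lemma eigenbase_nonempty : ~ (forall x, f x = 0) ->
  exists l : R, 0 < l /\ exists p, eigenbase l p.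
Proof.
move=> f0; have [l [l0 [u [cu u0 Tu]]]] := conv_eigenfunction cG hmu cf hf f0.
exists l; split=> //; pose c := (sqnorm u)^-1.
have cc := ccont_correlation cG hmu cu cu.
have cp : ccont (fun x => c%:C%C * correlation mu u u x).
  by apply: ccontM => //; exact: ccont_cst.
exists (fun x => c%:C%C * correlation mu u u x); split; last first.
  by rewrite correlation0 -rmorphM /= mulVf ?gt_eqF.
split=> //.
  by apply: pdfZ; [rewrite invr_ge0 ltW|exact: pdf_correlation].
move=> x.
have -> : T (fun x => c%:C%C * correlation mu u u x) =
    (fun x => c%:C%C * correlation mu (T u) u x).
  by apply/funext => y; rewrite convZ// conv_correlation.
rewrite convZ//; last by apply: ccont_correlation => //; exact: cT.
rewrite conv_correlation//; last exact: cT.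
rewrite mulrCA; congr (_ * _).
rewrite /correlation -ICZ//.
  by apply: eq_IC => y; rewrite Tu mulrA.
by apply: ccontM; [exact: ccont_addl|exact: ccontJ].
Qed.

Lemma eigenbase_nsq_le l p : eigenbase l p -> forall x, nsq (p x) <= 1.
Proof. by move=> [[_ pp _] p0] x; have := pdf_nsq_le pp x; rewrite p0 /= expr1n. Qed.

(** A smear is a combination of translates, and [T] commutes with these. *)
Lemma eigencone_smear l p s : eigencone l p -> eigencone l (smear p s).
Proof.
move=> [cp pp Tp].
have Tsm (L : seq (G * R[i])) (g : G -> R[i]) : ccont g ->
    T (fun y => wsum L (fun x => g (y + x))) = (fun y => wsum L (fun x => T g (y + x))).
  move=> cg; apply/funext => x; rewrite /conv /wsum.
  have cga a : ccont (fun y => g (y + a)) := ccont_addr a cg.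
  transitivity (IC (fun y => \sum_(w <- L) w.2 * (f (x - y) * g (y + w.1)))).
    by apply: eq_IC => y; rewrite mulr_sumr; apply: eq_bigr => w _; rewrite mulrCA.
  have cw (w : G * R[i]) : ccont (fun y => f (x - y) * g (y + w.1)).
    by apply: ccontM => //; exact: ccont_subl.
  rewrite IC_sum//; last by move=> w; apply: ccontM => //; exact: ccont_cst.
  apply: eq_bigr => w _; rewrite ICZ//; congr (_ * _).
  exact: (conv_translate cG hmu cf).
split; [exact: ccont_smear|exact: pdf_smear|].
move=> x; rewrite /smear Tsm// Tsm; last exact: cT.
by rewrite -wsumZ; apply: eq_bigr => w _; rewrite Tp.
Qed.

(** A maximizing sequence is equicontinuous because [l p = T (T p)]; all defining conditions and the
    norm pass to a uniform cluster point. *)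
Lemma eigenbase_max (l : R) : 0 < l -> (exists p, eigenbase l p) ->
  exists2 p, eigenbase l p & forall q, eigenbase l q -> sqnorm q <= sqnorm p.
Proof.
move=> l0 [p0 Qp0]; pose M := sup [set sqnorm p | p in eigenbase l].
have hs : has_sup [set sqnorm p | p in eigenbase l].
  split; first by exists (sqnorm p0); exists p0.
  exists 1 => _ [p Qp <-]; apply: sqnorm_le => //; first by have [[]] := Qp.
  exact: eigenbase_nsq_le Qp.
have [B B0 HB] := compact_ccont_bounded cG cf.
have exp n : exists p, eigenbase l p /\ M - n.+1%:R^-1 < sqnorm p.
  have [|_ [p Qp <-] pn] := @sup_adherent _ _ n.+1%:R^-1 _ hs.
    by rewrite invr_gt0.
  by exists p.
have [p_ Hp] := choice exp.
have [|x0 e e0|u Hu] := @equicontinuous_uniform_cluster _ _ cG p_ 1.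
- by move=> n; exact: eigenbase_nsq_le (Hp n).1.
(* The division by [B] absorbs [sqnorm (T p) <= B], and [l ^+ 2] comes from [l p = T (T p)]. *)
- have e1 : 0 < e * l ^+ 2 / B by rewrite divr_gt0// mulr_gt0// exprn_gt0.
  have := conv_equicontinuous cG hmu cf x0 e1; apply: filterS => x Hx n.
  have Qn := (Hp n).1; have [[cp pp Tp] _] := Qn.
  rewrite -(@ler_pM2l _ (l ^+ 2)) ?exprn_gt0// -nsq_real -nsqM mulrBr -!Tp.
  apply: le_trans (Hx _ (cT cp)) _.
  apply: (@le_trans _ _ (e * l ^+ 2 / B * B)).
    rewrite ler_wpM2l ?(ltW e1)//; apply: le_trans (sqnorm_conv_le cG hmu cf HB cp) _.
    by rewrite ler_piMr ?(ltW B0)// sqnorm_le//; exact: eigenbase_nsq_le Qn.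
  by rewrite nsq_real divfK ?gt_eqF// mulrC.
have small (e : R) : 0 < e -> exists2 p, eigenbase l p /\ M - sqnorm p <= e &
    forall x, nsq (u x - p x) <= e ^+ 2.
  move=> e0; have [k] := ltr_add_invr e0; rewrite add0r => ke.
  have [|n kn Hn] := Hu (e ^+ 2) k; first by rewrite exprn_gt0.
  exists (p_ n) => //; split; first exact: (Hp n).1.
  apply: (@le_trans _ _ n.+1%:R^-1); first by rewrite lerBlDr -lerBlDl ltW// (Hp n).2.
  by apply: le_trans (ltW ke); rewrite lef_pV2 ?posrE// ler_nat.
have small2 (e : R) : 0 < e -> exists2 p, eigenbase l p & forall x, nsq (u x - p x) <= e.
  move=> e0; have [|p [Qp _] Hpe] := small (Num.sqrt e); first by rewrite sqrtr_gt0.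
  by exists p => // x; rewrite (le_trans (Hpe x))// sqr_sqrtr// ltW.
have cu : ccont u.
  apply: ccont_uniform_limit => e e0.
  by have [p [[cp _ _] _] ?] := small2 e e0; exists p.
have Qu : eigenbase l u.
  split; first split=> //.
  - by apply: pdf_uniform_limit => e /small2[p [[_ pp _] _] ?]; exists p.
  - move=> x; apply/eqP; rewrite -subr_eq0; apply/eqP/nsq_eq0.
    apply: (@le0_small _ _ (2 * (B * B) + 2 * l ^+ 2)).
      by rewrite addr_ge0// mulr_ge0// ?sqr_ge0// mulr_ge0// ltW.
    move=> e e0; have [p [[cp _ Tp] _] Hpe] := small2 e e0.
    pose d y := u y - p y; have cd : ccont d by apply: ccontB.
    have Nd : sqnorm d <= e by apply: sqnorm_le.
    have TTd : nsq (T (T d) x) <= B * (B * e).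
      apply: le_trans (nsq_conv_le cG hmu cf HB (cT cd) x) _.
      rewrite ler_wpM2l ?(ltW B0)//.
      apply: le_trans (sqnorm_conv_le cG hmu cf HB cd) _.
      by rewrite ler_wpM2l ?(ltW B0).
    have ld : nsq (l%:C%C * d x) <= l ^+ 2 * e.
      by rewrite nsqM nsq_real ler_wpM2l ?sqr_ge0// Hpe.
    have TTdE : T (T d) x = T (T u) x - T (T p) x.
      have -> : T d = (fun y => T u y - T p y) by apply/funext => y; rewrite convB.
      by rewrite convB//; exact: cT.
    have -> : T (T u) x - l%:C%C * u x = T (T d) x - l%:C%C * d x.
      rewrite TTdE Tp /d; move: (T (T u) x) (u x) (p x) => a b c; ring.
    apply: le_trans (nsqB _ _) _; move: TTd ld; lra.
  - apply/eqP; rewrite -subr_eq0; apply/eqP/nsq_eq0.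
    apply: (@le0_small _ _ 1) => // e /small2[p [_ p01] /(_ 0)].
    by rewrite p01 mul1r.
exists u => // q Qq; have qM : sqnorm q <= M.
  by apply: ub_le_sup; [exact: hs.2|exists q].
(* The constant [4] adds the error [e] in [M - sqnorm p] to the [3 * e] in comparing [p] with
   [u]. *)
apply: le_trans qM _; rewrite -subr_le0; apply: (@le0_small _ _ 4) => // e0 e00.
pose e := Num.min 1 e0.
have e1 : e <= 1 by rewrite ge_min lexx.
have ee0 : e <= e0 by rewrite ge_min lexx orbT.
have ep : 0 < e by rewrite lt_min ltr01.
have [p [Qp Mp] Hpe] := small e ep.
have [[cp _ _] _] := Qp.
have : sqnorm p <= sqnorm u + 3 * e.
  rewrite -(IR_cst hmu (3 * e)) -IRD//; last 2 first.
  - exact: continuous_nsq.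
  - by move=> x; exact: cvg_cst.
  apply: le_IR => //; first exact: continuous_nsq.
    by move=> x; apply: cvgD; [exact: continuous_nsq|exact: cvg_cst].
  move=> x; have u1 := eigenbase_nsq_le Qu x.
  have := Hpe x; have := nsq_ge0 (e%:C%C * u x + (u x - p x)); move: u1.
  rewrite /nsq !partsE /=; move: (Re (u x)) (Im (u x)) (Re (p x)) (Im (p x)) => a b c d.
  move=> h1 h2 h3.
  (* Expanding the square and dividing by [2 e] bounds the inner product of [u x] and [u x - p x]
     below by [- e]; then [nsq (p x)] exceeds [nsq (u x)] by at most [2 e + e ^+ 2 <= 3 e]. *)
  have h4 : 0 <= e * (2 * e + 2 * (a * (a - c) + b * (b - d))) by nra.
  have h5 : 0 <= 2 * e + 2 * (a * (a - c) + b * (b - d)).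
    by rewrite -(@pmulr_rge0 _ e).
  nra.
move: Mp ee0; lra.
Qed.

(** Strict convexity of the L2 norm: after normalizing to [A] and [B], [p] is their weighted mean,
    and maximality of its norm forces [A = B]. *)
Lemma eigencone_extremal (l : R) p (q1 q2 : G -> R[i]) (k : R) :
    eigenbase l p -> (forall q, eigenbase l q -> sqnorm q <= sqnorm p) ->
    eigencone l q1 -> eigencone l q2 -> 0 < k ->
    (forall x, q1 x + q2 x = k%:C%C * p x) ->
  forall x, q1 x = q1 0 * p x.
Proof.
move=> Qp maxp Q1 Q2 k0 qE.
have [c1 p1 T1] := Q1; have [c2 p2 T2] := Q2; have [[cp pp Tp] p01] := Qp.
have /ge0_parts[a0 _] := pdf0_ge0 p1; have /ge0_parts[b0 _] := pdf0_ge0 p2.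
set a := Re (q1 0) in a0; set b := Re (q2 0) in b0.
have aE : q1 0 = a%:C%C := pdf0E p1.
have bE : q2 0 = b%:C%C := pdf0E p2.
have abk : a + b = k.
  by have := qE 0; rewrite aE bE p01 mulr1 -rmorphD => -[].
(* A positive definite function vanishing at [0] is zero, which settles the cases where
   normalization is impossible. *)
have [a1|a1] := leP a 0.
  have q10 : q1 0 = 0.
    by rewrite aE (_ : a = 0)//; apply/eqP; rewrite eq_le a1 a0.
  by move=> x; rewrite q10 mul0r; exact: pdf_eq0.
have [b1|b1] := leP b 0.
  have bb0 : b = 0 by apply/eqP; rewrite eq_le b1 b0.
  have q20 : q2 0 = 0 by rewrite bE bb0.
  by move=> x; have := qE x; rewrite (pdf_eq0 p2)// addr0 -abk bb0 addr0 aE.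
have normalize c q : 0 < c -> eigencone l q -> q 0 = c%:C%C ->
    eigenbase l (fun x => (c^-1)%:C%C * q x).
  move=> c0 [cq pq Tq] q0; split; last by rewrite q0 -rmorphM /= mulVf ?gt_eqF.
  split.
  - by apply: ccontM => //; exact: ccont_cst.
  - by apply: pdfZ => //; rewrite invr_ge0 ltW.
  - move=> x.
    have -> : T (fun x => (c^-1)%:C%C * q x) = (fun x => (c^-1)%:C%C * T q x).
      by apply/funext => y; rewrite convZ.
    by rewrite convZ ?Tq//; [rewrite mulrCA|exact: cT].
pose A x := (a^-1)%:C%C * q1 x; pose B x := (b^-1)%:C%C * q2 x.
have QA : eigenbase l A by apply: normalize.
have QB : eigenbase l B by apply: normalize.
have [[cA _ _] _] := QA; have [[cB _ _] _] := QB.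
have q1A x : q1 x = a%:C%C * A x by rewrite /A mulrA -rmorphM /= mulfV ?gt_eqF// mul1r.
have q2B x : q2 x = b%:C%C * B x by rewrite /B mulrA -rmorphM /= mulfV ?gt_eqF// mul1r.
have cAB : ccont (fun x => A x - B x) by apply: ccontB.
(* The weighted parallelogram identity for [k p = a A + b B] with [k = a + b]. *)
have NE : k ^+ 2 * sqnorm p + a * b * sqnorm (fun x => A x - B x) =
    k * a * sqnorm A + k * b * sqnorm B.
  rewrite /sqnorm -!IRZ//; try exact: continuous_nsq.
  rewrite -!IRD//; try (apply: continuous_scale; exact: continuous_nsq).
  congr (IR mu _); apply/funext => x.
  rewrite -nsq_real -nsqM -qE q1A q2B -abk /nsq !partsE /=; ring.
have AB0 : sqnorm (fun x => A x - B x) <= 0.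
  have := maxp _ QA; have := maxp _ QB; move: NE.
  move: (sqnorm p) (sqnorm A) (sqnorm B) (sqnorm (fun x => A x - B x)) => n nA nB d NE hB hA.
  have hkA : k * a * nA <= k * a * n by apply: ler_wpM2l hA; exact: mulr_ge0 (ltW k0) a0.
  have hkB : k * b * nB <= k * b * n by apply: ler_wpM2l hB; exact: mulr_ge0 (ltW k0) b0.
  have kk : k ^+ 2 * n = k * a * n + k * b * n by rewrite -abk; ring.
  have : a * b * d <= 0 by move: NE; rewrite kk; lra.
  by rewrite pmulr_rle0// mulr_gt0.
move=> x; have /eqP := sqnorm_eq0 cG hmu cAB AB0 x; rewrite subr_eq0 => /eqP AB.
have := qE x; rewrite q1A q2B -AB -mulrDl -rmorphD /= abk => kA.
rewrite aE; congr (_ * _); apply: (mulfI _ kA).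
by rewrite -(rmorph0 (real_complex R)) (inj_eq (@complexI R)) gt_eqF.
Qed.

(** Extremality applied to the smears with weights [c] and [- c] at [y] gives [main]; dividing its
    case [c = 'i] by ['i] and adding the case [c = 1] cancels [p (x - y)]. *)
Lemma eigenbase_extremal_morph (l : R) p :
    eigenbase l p -> (forall q, eigenbase l q -> sqnorm q <= sqnorm p) ->
  forall x y, p (x + y) = p x * p y.
Proof.
move=> Qp maxp x y; have [Kp p01] := Qp.
have main (c : R[i]) : nsq c = 1 ->
    c^* * p (x - y) + c * p (x + y) = (c^* * p (- y) + c * p y) * p x.
  move=> c1; have ccE : c * c^* = 1 by rewrite mulcJ_nsq c1.
  have sumE z : smear p [:: (0, 1); (y, c)] z + smear p [:: (0, 1); (y, - c)] z =
      4%:C%C * p z.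
    rewrite !smear2 rmorphN mulrNN ccE (_ : (4%:C)%C = 4 :> R[i]) ?rmorphMn//.
    by move: (p z) (p (z - y)) (p (z + y)) => p1 p2 p3; ring.
  have := eigencone_extremal Qp maxp (eigencone_smear _ Kp) (eigencone_smear _ Kp)
    (ltr0n _ 4) sumE x.
  rewrite !smear2 !sub0r !add0r p01 ccE.
  move: (p (x - y)) (p (x + y)) (p (- y)) (p y) (p x) => a b d e g H.
  apply: (addrI (g + g)); transitivity (g + c^* * a + (c * b + 1 * g)); first by ring.
  by rewrite H; ring.
have := main (Complex 0 1); rewrite {1}/nsq /= expr0n expr1n add0r => /(_ erefl).
have := main 1; rewrite {1}/nsq /= expr0n expr1n addr0 => /(_ erefl).
move: (p (x - y)) (p (x + y)) (p (- y)) (p y) (p x) => a b d e g.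
move=> h1 h2; apply: complex_ext.
  have := congr1 (@complex.Re R) h1; have := congr1 (@complex.Im R) h2.
  by rewrite !partsE /=; lra.
have := congr1 (@complex.Im R) h1; have := congr1 (@complex.Re R) h2.
by rewrite !partsE /=; lra.
Qed.

(** The character [p] is an eigenfunction of [T] itself, with eigenvalue the conjugate of
    [fourier mu f p]; if this were zero, [T (T p) 0 = l] would contradict [l > 0]. *)
Lemma exists_character_fourier_neq0 : ~ (forall x, f x = 0) ->
  exists2 g : G -> R[i], character g & fourier mu f g != 0.
Proof.
move=> /eigenbase_nonempty[l [l0 /(eigenbase_max l0)[p Qp maxp]]].
have pM := eigenbase_extremal_morph Qp maxp.
have [[cp pp Tp] p01] := Qp.
have p1 x : nsq (p x) = 1.
  have := pM x (- x); rewrite subrr p01 (pdf_hermitian pp) mulcJ_nsq => -[] <-.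
  by [].
exists p.
  by split; [exact/ccontP|split=> // x; apply/norm1_nsq].
(* The substitution of [y + x] for [y] turns [f (x - y)] into [f (- y)], the conjugate of [f y], and
   splits off [p x]. *)
have TE x : T p x = (fourier mu f p)^* * p x.
  have -> : fourier mu f p = IC (fun y => f y * (p y)^*) by [].
  have cfp : ccont (fun y => f y * (p y)^*) by apply: ccontM => //; exact: ccontJ.
  rewrite -ICJ// -ICZr//; last exact: ccontJ.
  rewrite /conv -(@IC_translate _ _ cG mu hmu (fun y => f (x - y) * p y) x).
    apply: eq_IC => y; rewrite opprD addrCA subrr addr0 hf pM.
    by rewrite rmorphM /= conjCK mulrA.
  by apply: ccontM => //; exact: ccont_subl.
apply/eqP => F0; have := Tp 0.
have -> : T p = (fun _ => 0) by apply/funext => x; rewrite TE F0 conjC0 mul0r.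
rewrite p01 mulr1 /conv.
have -> : IC (fun y => f (0 - y) * 0) = 0.
  by rewrite -[RHS](IC0 hmu); apply: eq_IC => y; rewrite mulr0.
by case=> l00; rewrite -l00 ltxx in l0.
Qed.

End ExtremalCharacter.

(** * Elementary properties of characters *)

Section CharacterFacts.
Context {R : realType} {G : topologicalZmodType}.
Variable g : G -> R[i].
Hypothesis hg : character g.

Lemma character0 : g 0 = 1.
Proof.
have [_ [gM /(_ 0)/norm1_nsq g1]] := hg.
have g0 : g 0 != 0 by apply/eqP => g0; move/eqP: g1; rewrite g0 nsq0 eq_sym oner_eq0.
by apply: (mulfI g0); rewrite -gM addr0 mulr1.
Qed.

Lemma characterN x : g (- x) = (g x)^*.
Proof.
have [_ [gM /(_ x)/norm1_nsq g1]] := hg.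
have g0 : g x != 0 by apply/eqP => g0; move/eqP: g1; rewrite g0 nsq0 eq_sym oner_eq0.
by apply: (mulfI g0); rewrite -gM subrr character0 mulcJ_nsq g1.
Qed.

Lemma wsum_diffs_character s : wsum (diffs s) g = (nsq (wsum s g))%:C%C.
Proof.
have [_ [gM _]] := hg.
rewrite -mulcJ_nsq wsum_diffs /wsum mulr_suml; apply: eq_bigr => u _.
rewrite rmorph_sum mulr_sumr; apply: eq_bigr => v _ /=.
by rewrite gM characterN rmorphM /= mulrACA.
Qed.

End CharacterFacts.

(** * Reduction to distinct points with nonzero weights *)

Section Merge.
Context {R : realType} {G : zmodType}.
Implicit Types (f : G -> R[i]) (s : seq (G * R[i])).

(** The same measure with distinct points; [reduce] also drops zero weights, which meets both
    conditions of strict positive definiteness. *)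
Definition merge_points s : seq (G * R[i]) :=
  [seq (z, \sum_(u <- s | u.1 == z) u.2) | z <- undup (unzip1 s)].

Definition reduce s := [seq u <- merge_points s | u.2 != 0].

Lemma wsum_filter s f : wsum [seq u <- s | u.2 != 0] f = wsum s f.
Proof.
rewrite /wsum big_filter big_mkcond; apply: eq_bigr => u _ /=.
by case: eqP => //= ->; rewrite mul0r.
Qed.

Lemma wsum_merge s f : wsum (merge_points s) f = wsum s f.
Proof.
rewrite /wsum big_map /=; under eq_bigr do rewrite mulr_suml big_mkcond /=.
rewrite exchange_big big_seq [RHS]big_seq; apply: eq_bigr => u us /=.
rewrite (bigD1_seq u.1) /= ?undup_uniq//; last first.
  by rewrite mem_undup; apply: map_f.
rewrite eqxx big1 ?addr0// => z /negbTE; by rewrite eq_sym => ->.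
Qed.

Lemma wsum_reduce s f : wsum (reduce s) f = wsum s f.
Proof. by rewrite wsum_filter wsum_merge. Qed.

(** Written as two nested integrals against [s], the quadratic form is seen to depend only on the
    measure, not on the list. *)
Lemma wsum_diffs_twice s f : wsum (diffs s) f =
  wsum s (fun a => (wsum s (fun b => (f (a - b))^*))^*).
Proof.
rewrite wsum_diffs; apply: eq_bigr => u _; rewrite /wsum rmorph_sum mulr_sumr.
by apply: eq_bigr => v _; rewrite rmorphM /= conjCK mulrA.
Qed.

Lemma wsum_diffs_reduce s f : wsum (diffs (reduce s)) f = wsum (diffs s) f.
Proof.
rewrite !wsum_diffs_twice wsum_reduce; congr wsum; apply/funext => a.
by rewrite wsum_reduce.
Qed.

Lemma reduce_uniq s : uniq (unzip1 (reduce s)).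
Proof.
have : subseq (unzip1 (reduce s)) (unzip1 (merge_points s)).
  by apply: map_subseq; exact: filter_subseq.
move=> /subseq_uniq; apply; rewrite /unzip1 /merge_points -map_comp.
by rewrite (eq_map (_ : _ =1 id)) ?map_id ?undup_uniq.
Qed.

Lemma reduce_neq0 s : all (fun u => u.2 != 0) (reduce s).
Proof. exact: filter_all. Qed.

End Merge.

(** * Fourier coefficients of smeared functions *)

Section SmearFourier.
Context {R : realType} {G : topologicalZmodType} (cG : compact [set: G]).
Variable mu : {measure set (borel_type G) -> \bar R}.
Hypothesis hmu : haar_probability mu.
Implicit Types (f : G -> R[i]) (s : seq (G * R[i])).

Lemma smear_hermitian f s : (forall x, f (- x) = (f x)^*) ->
  forall x, smear f s (- x) = (smear f s x)^*.
Proof.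
move=> hf x; rewrite /smear !wsum_diffs exchange_big /= rmorph_sum.
apply: eq_bigr => u _; rewrite rmorph_sum; apply: eq_bigr => v _ /=.
by rewrite !rmorphM /= conjCK -hf opprD opprB [v.2 * _]mulrC.
Qed.

(** Translating [f] by [a] multiplies its coefficient at [g] by [g a]; summing over [diffs s]
    produces the squared modulus of [wsum s g]. *)
Lemma fourier_smear f s (g : G -> R[i]) : ccont f -> character g ->
  fourier mu (smear f s) g = (nsq (wsum s g))%:C%C * fourier mu f g.
Proof.
move=> cf hg; have [/ccontP cg [gM _]] := hg.
have -> (h : G -> R[i]) : fourier mu h g = IC mu (fun y => h y * (g y)^*) by [].
have cJ := ccontJ cg.
have cw (a : G) : ccont (fun y => f (y + a) * (g y)^*).
  by apply: ccontM => //; exact: ccont_addr.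
rewrite -(wsum_diffs_character hg) /smear /wsum mulr_suml.
transitivity (IC mu (fun y => \sum_(w <- diffs s) w.2 * (f (y + w.1) * (g y)^*))).
  by apply: eq_IC => y; rewrite mulr_suml; apply: eq_bigr => w _; rewrite mulrA.
rewrite IC_sum//; last by move=> w; apply: ccontM => //; exact: ccont_cst.
apply: eq_bigr => w _; rewrite ICZ// -mulrA; congr (_ * _).
rewrite -ICZ//; last by apply: ccontM.
rewrite -[RHS](@IC_translate _ _ cG mu hmu _ w.1).
  apply: eq_IC => y; rewrite gM rmorphM /= mulrCA; congr (_ * _).
  rewrite mulrCA -(characterN hg w.1) -gM subrr (character0 hg) mulr1.
  by [].
by apply: ccontM; [exact: ccont_cst|apply: ccontM].
Qed.

(** All Fourier coefficients of the smear vanish, and it is continuous and hermitian. *)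
Lemma smear_eq0 f s : ccont f -> (forall x, f (- x) = (f x)^*) ->
    (forall g, character g -> fourier mu f g != 0 -> wsum s g = 0) ->
  forall y, smear f s y = 0.
Proof.
move=> cf hf Hs; apply: contrapT => f0.
have [g hg] := exists_character_fourier_neq0 cG hmu (ccont_smear s cf)
  (smear_hermitian s hf) f0.
rewrite fourier_smear//; have [->|F0] := eqVneq (fourier mu f g) 0.
  by rewrite mulr0 eqxx.
by rewrite (Hs _ hg F0) nsq0 mul0r eqxx.
Qed.

End SmearFourier.

(** A Urysohn function [psi] separating [0] from [D], made even by the product [psi x * psi (- x)];
    being real and even, it is hermitian. *)
Lemma even_bump {R : realType} {G : topologicalZmodType} (hG : hausdorff_space G)
    (cG : compact [set: G]) (D : set G) : finite_set D -> ~ D 0 ->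
  exists phi : G -> R[i], [/\ ccont phi, forall x, phi (- x) = (phi x)^*,
    phi 0 = 1 & forall x, D x -> phi x = 0].
Proof.
move=> fD D0; have nG := compact_normal hG cG.
have /accessible_finite_set_closed cfin := hausdorff_accessible hG.
have cD := cfin _ fD; have c0 := cfin _ (finite_set1 (0 : G)).
have dis : D `&` [set 0] = set0 by apply/seteqP; split=> // x [/[swap] ->].
have [psi [cpsi pD p0 _]] := @urysohn_ext_itv G R nG _ _ 0 1 cD c0 dis ltr01.
have psi0 : psi 0 = 1 by apply: p0; exists 0.
exists (fun x => (psi x * psi (- x))%:C%C); split.
- apply: ccont_real => x; apply: cvgM; first exact: cpsi.
  apply: (@continuous_comp _ _ _ (-%R : G -> G) psi); last exact: cpsi.
  exact: opp_continuous.
- by move=> x; apply: complex_ext; rewrite !partsE /= ?oppr0 // opprK mulrC.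
- by rewrite oppr0 psi0 mulr1.
- move=> x Dx; have -> : psi x = 0 by apply: pD; exists x.
  by rewrite mul0r.
Qed.

(** * The two implications *)

Section Main.
Context {R : realType} {G : topologicalZmodType}.
Hypotheses (hG : hausdorff_space G) (cG : compact [set: G]).
Variable mu : {measure set (borel_type G) -> \bar R}.
Hypothesis hmu : haar_probability mu.
Variable f : G -> R[i].
Hypotheses (cf : ccont f) (fpd : positive_definite f).

Let pf := positive_definite_pdf fpd.
Let hf := pdf_hermitian pf.

Lemma trig_poly_wsum n (x : 'I_n -> G) (c : 'I_n -> R[i]) (g : G -> R[i]) :
  trig_poly x c g = wsum [seq (x i, c i) | i <- index_enum 'I_n] g.
Proof. by rewrite /wsum big_map. Qed.

(** If the polynomial vanishes on the support, the quadratic form of its reduced list is zero;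
    strict positivity leaves only the empty list, so the polynomial is zero. *)
Lemma spd_spd_support : strictly_positive_definite f ->
  spd_subset [set g : G -> R[i] | character g /\ fourier mu f g != 0].
Proof.
move=> [_ sf] n x c Hx g hg; rewrite trig_poly_wsum.
set s := [seq _ | _ <- _].
have s0 : wsum (diffs (reduce s)) f = 0.
  rewrite wsum_diffs_reduce -smear0; apply: (smear_eq0 cG hmu cf hf) => g' hg' F.
  by rewrite -trig_poly_wsum; apply: Hx.
rewrite -wsum_reduce.
move: s0 (reduce_uniq s) (reduce_neq0 s); move: (reduce s) => {s}s + us ns.
rewrite wsum_diffs_nth; case E : (size s) => [|m].
  by rewrite (size0nil E) /wsum big_nil.
move=> s0; exfalso.
have : 0 < pd_sum f (fun i : 'I_m.+1 => (nth (0, 0) s i).1) (fun i => (nth (0, 0) s i).2).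
  apply: sf.
    by move=> i; apply: (allP ns); rewrite mem_nth// E.
  move=> i j; rewrite -!(nth_map (0, 0) 0 fst) ?E// => /eqP.
  by rewrite nth_uniq ?size_map ?E// => /eqP/val_inj.
by rewrite s0 ltxx.
Qed.

Lemma spd_support_spd :
    spd_subset [set g : G -> R[i] | character g /\ fourier mu f g != 0] ->
  strictly_positive_definite f.
Proof.
move=> Hs; split=> // n x c c0 xI; rewrite lt_def fpd// andbT; apply/eqP => p0.
pose s := [seq (x i, c i) | i <- index_enum 'I_n.+1].
have sm0 : forall y, smear f s y = 0.
  by apply: pdf_eq0; [exact: pdf_smear|rewrite smear0 -pd_sum_wsum].
have s0 g : character g -> wsum s g = 0.
  move=> hg; rewrite -trig_poly_wsum; apply: Hs hg => g' [hg' F0].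
  rewrite trig_poly_wsum; apply: nsq_eq0.
  have : fourier mu (smear f s) g' = 0.
    have -> : smear f s = (fun _ => 0) by apply/funext.
    rewrite -[RHS](IC0 hmu); apply: (@eq_IC _ _ mu) => y.
    by rewrite mul0r.
  rewrite fourier_smear// => /eqP; rewrite mulf_eq0 (negbTE F0) orbF.
  by move=> /eqP[->].
(* Off-diagonal differences; injectivity of [x] keeps [0] out, and a bump vanishing on [D] retains
   only the diagonal of the quadratic form. *)
pose D := [set z | exists i j, i != j /\ z = x i - x j].
have fD : finite_set D.
  apply: (@sub_finite_set _ _ [set x ij.1 - x ij.2 | ij in [set: 'I_n.+1 * 'I_n.+1]]).
    by move=> z [i [j [_ ->]]]; exists (i, j).
  exact/finite_image/finite_finset.
have D0 : ~ D 0.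
  move=> [i [j [/eqP ij /esym/eqP]]]; rewrite subr_eq0 => /eqP/xI; exact: ij.
have [phi [cphi hphi phi0 phiD]] := @even_bump R G hG cG D fD D0.
(* The polynomial now vanishes at every character, so this applies to [phi] whatever its Fourier
   support. *)
have := smear_eq0 cG hmu (s := s) cphi hphi (fun g hg _ => s0 g hg) 0.
rewrite smear0 -pd_sum_wsum /pd_sum.
have -> : \sum_(i < n.+1) \sum_(j < n.+1) c i * (c j)^* * phi (x i - x j) =
    \sum_(i < n.+1) c i * (c i)^*.
  apply: eq_bigr => i _; rewrite (bigD1 i)//= subrr phi0 mulr1 big1 ?addr0// => j ji.
  by rewrite phiD ?mulr0//; exists i, j; rewrite eq_sym.
move=> /eqP; rewrite psumr_eq0; last by move=> i _; rewrite mul_conjC_ge0.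
by move=> /allP/(_ ord0 (mem_index_enum _)); rewrite /= mul_conjC_eq0 (negbTE (c0 _)).
Qed.

End Main.

Theorem theorem2p2 (R : realType) (G : topologicalZmodType)
    (hG : hausdorff_space G) (cG : compact [set: G])
    (mu : {measure set (borel_type G) -> \bar R})
    (hmu : haar_probability mu)
    (f : G -> R[i]) (fcont : continuous f) (fpd : positive_definite f) :
  strictly_positive_definite f <->
  spd_subset [set g : G -> R[i] | character g /\ fourier mu f g != 0].
Proof.
have cf : ccont f by apply/ccontP.
by split; [exact: spd_spd_support|exact: spd_support_spd].
Qed.
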